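(* Let $m,n\ge 1$ be integers with $n\neq m$. Let $\Omega$ be a class of unital $C^*$-algebras such that every $B\in\Omega$ is weakly $(m,n)$-divisible. Let $A\in\mathrm{WTA}\Omega$ be a simple unital stably finite $C^*$-algebra such that for every integer $k\in\mathbb N$ (with $k\geq 1$) the $C^*$-algebra $M_k(A)$ belongs to the class $\mathrm{WTA}\Omega$. Then $A$ is secondly weakly $(m,n)$-divisible.
   Context: Notation. For a $C^*$-algebra $A$ and positive elements $a,b\in A$, write $a\precsim b$ ($a$ is Cuntz subequivalent to $b$) if there is a sequence $(r_k)_{k\ge1}$ in $A$ with $\lim_{k\to\infty}\|r_kbr_k^*-a\|=0$; write $a\sim b$ if $a\precsim b$ and $b\precsim a$. $M_\infty(A)=\bigcup_{k}M_k(A)$, where $M_k(A)$ is embedded in $M_{k+1}(A)$ as the top left corner. For $a\in M_k(A)_+$ and $b\in M_l(A)_+$, $a\precsim b$ means that $a$ is Cuntz subequivalent to $b$ when both are regarded (after padding with zeros) as elements of $M_{\max\{k,l\}}(A)$. $\langle a\rangle$ denotes the Cuntz equivalence class of $a\in M_\infty(A)_+$; these classes form an ordered semigroup with $\langle a\rangle+\langle b\rangle=\langle a\oplus b\rangle$ and $\langle a\rangle\le\langle b\rangle$ iff $a\precsim b$. $m\langle x\rangle$ is the $m$-fold sum of $\langle x\rangle$. For positive $a$ and $\varepsilon>0$, $(a-\varepsilon)_+$ is obtained by functional calculus with $f(t)=\max(0,t-\varepsilon)$. For $x\in A$, a subset $B\subseteq A$ and $\varepsilon>0$, write $x\in_\varepsilon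 B$ if there is $b\in B$ with $\|x-b\|<\varepsilon$. The class $\mathrm{WTA}\Omega$. Let $\Omega$ be a class of unital $C^*$-algebras. A simple unital $C^*$-algebra $A$ belongs to the class $\mathrm{WTA}\Omega$ if, for any $\varepsilon>0$, any finite subset $F\subseteq A$, and any nonzero element $a\ge 0$ of $A$, there exist a projection $p\in A$, an element $g\in A$ with $0\le g\le 1$, and a unital $C^*$-subalgebra $B$ of $A$ with $g\in B$, $1_B=p$ and $B\in\Omega$, such that (1) $(p-g)x\in_\varepsilon B$ and $x(p-g)\in_\varepsilon B$ for all $x\in F$; (2) $\|(p-g)x-x(p-g)\|<\varepsilon$ for all $x\in F$; (3) $1-(p-g)\precsim a$; (4) $\|(p-g)a(p-g)\|\ge\|a\|-\varepsilon$. Divisibility. Let $A$ be a unital $C^*$-algebra and $m,n\ge1$ integers. - $A$ is weakly $(m,n)$-divisible if for every $a\in M_\infty(A)_+$ and every $\varepsilon>0$ there exist $x_1,\dots,x_n\in M_\infty(A)_+$ such that $m\langle x_j\rangle\le\langle a\rangle$ for all $j=1,\dots,n$ and $\langle(a-\varepsilon)_+\rangle\le\langle x_1\rangle+\cdots+\langle x_n\rangle$. - $A$ is secondly weakly $(m,n)$-divisible if for every $a\in M_\infty(A)_+$ and every $\varepsilon>0$ there exist $x_1,\dots,x_n\in M_\infty(A)_+$ such that $m\langle x_j\rangle\le\langle a\rangle+\langle a\rangle$ for all $j=1,\dots,n$ and $\langle(a-\varepsilon)_+\rangle\le\langle x_1\rangle+\cdots+\langle x_n\rangle$. *)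

(* Defs.v *)
From HB Require Import structures.
From mathcomp Require Import all_boot all_order all_algebra.
From mathcomp Require Import complex.
From mathcomp Require Import all_classical all_reals all_analysis.

Set Implicit Arguments.
Unset Strict Implicit.
Unset Printing Implicit Defensive.

Import Order.TTheory GRing.Theory Num.Theory.
Import numFieldNormedType.Exports.

Local Open Scope classical_set_scope.
Local Open Scope ring_scope.

HB.mixin Record Algebra_isStarAlgebra (R : rcfType) A of GRing.Algebra R[i] A := {
  star : A -> A;
  starD : forall x y, star (x + y) = star x + star y;
  starZ : forall (c : R[i]) x, star (c *: x) = conjc c *: star x;
  starM : forall x y, star (x * y) = star y * star x;
  starK : involutive star
}.

#[short(type="starAlgType")]
HB.structure Definition StarAlgebra (R : rcfType) :=
  {A of GRing.Algebra R[i] A & Algebra_isStarAlgebra R A}.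

(* Unital C*-algebras; unital rings of the library satisfy 1 != 0. The norm is
   R-valued, and is not the norm of a normedModType R[i]: Hierarchy-Builder
   rejects a new join of rings and normed modules beside numDomainType. *)
HB.mixin Record StarAlgebra_isCStar (R : realType) A of StarAlgebra R A := {
  cnorm : A -> R;
  cnorm_eq0 : forall x, cnorm x = 0 -> x = 0;
  cnormD : forall x y, cnorm (x + y) <= cnorm x + cnorm y;
  cnormZ : forall (c : R[i]) x, cnorm (c *: x) = complex.Re `|c| * cnorm x;
  cnormM : forall x y, cnorm (x * y) <= cnorm x * cnorm y;
  cnorm_star : forall x, cnorm (star x * x) = cnorm x ^+ 2;
  cnorm_complete : forall u : nat -> A,
    (forall e : R, 0 < e -> exists n0 : nat, forall i j : nat,
       (n0 <= i)%N -> (n0 <= j)%N -> cnorm (u i - u j) < e) ->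
    exists l : A, (fun i => cnorm (u i - l)) @ \oo --> (0 : R)
}.

#[short(type="cstarType")]
HB.structure Definition CStarAlgebra (R : realType) :=
  {A of StarAlgebra R A & StarAlgebra_isCStar R A}.

(* [matalg A k] is M_(k+1)(A) as an algebra over R[i]. The alias is needed
   because the library module structure of 'M[A]_n has its scalars in A. *)
Definition matalg (R : rcfType) (A : starAlgType R) (k : nat) : Type :=
  'M[A]_k.+1.

Section MatrixStarAlgebra.
Variables (R : rcfType) (A : starAlgType R) (k : nat).
Local Notation M := (matalg A k).

HB.instance Definition _ := GRing.NzRing.copy M 'M[A]_k.+1.

Definition mat_scale (c : R[i]) (a : M) : M := \matrix_(i, j) (c *: a i j).

Fact mat_scaleA c d a : mat_scale c (mat_scale d a) = mat_scale (c * d) a.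
Proof. by apply/matrixP => i j; rewrite !mxE scalerA. Qed.
Fact mat_scale1 : left_id 1 mat_scale.
Proof. by move=> a; apply/matrixP => i j; rewrite !mxE scale1r. Qed.
Fact mat_scaleDr : right_distributive mat_scale +%R.
Proof. by move=> c a b; apply/matrixP => i j; rewrite !mxE scalerDr. Qed.
Fact mat_scaleDl a : {morph mat_scale^~ a : c d / c + d}.
Proof. by move=> c d; apply/matrixP => i j; rewrite !mxE scalerDl. Qed.

HB.instance Definition _ := GRing.Zmodule_isLmodule.Build R[i] M
  mat_scaleA mat_scale1 mat_scaleDr mat_scaleDl.

Fact mat_scaleAl (c : R[i]) (a b : M) : c *: (a * b) = (c *: a) * b.
Proof.
apply/matrixP => i j; rewrite !mxE scaler_sumr; apply: eq_bigr => l _.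
by rewrite !mxE scalerAl.
Qed.

HB.instance Definition _ := GRing.Lmodule_isLalgebra.Build R[i] M mat_scaleAl.

Fact mat_scaleAr (c : R[i]) (a b : M) : c *: (a * b) = a * (c *: b).
Proof.
apply/matrixP => i j; rewrite !mxE scaler_sumr; apply: eq_bigr => l _.
by rewrite !mxE scalerAr.
Qed.

HB.instance Definition _ := GRing.Lalgebra_isAlgebra.Build R[i] M mat_scaleAr.

Definition mat_star (a : M) : M := \matrix_(i, j) star (a j i).

Fact mat_starD a b : mat_star (a + b) = mat_star a + mat_star b.
Proof. by apply/matrixP => i j; rewrite !mxE starD. Qed.
Fact mat_starZ (c : R[i]) a : mat_star (c *: a) = conjc c *: mat_star a.
Proof. by apply/matrixP => i j; rewrite !mxE starZ. Qed.
Fact mat_starM a b : mat_star (a * b) = mat_star b * mat_star a.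
Proof.
apply/matrixP => i j; rewrite !mxE.
have star0 : star (0 : A) = 0.
  by apply: (@addrI _ (star 0)); rewrite -starD !addr0.
rewrite (big_morph star (@starD _ A) star0); apply: eq_bigr => l _.
by rewrite !mxE starM.
Qed.
Fact mat_starK : involutive mat_star.
Proof. by move=> a; apply/matrixP => i j; rewrite !mxE starK. Qed.

HB.instance Definition _ := Algebra_isStarAlgebra.Build R M
  mat_starD mat_starZ mat_starM mat_starK.

End MatrixStarAlgebra.

Section MatrixNorm.
Variables (R : realType) (A : cstarType R) (k : nat).

(* The norm of the right Hilbert A-module A^(k+1). *)
Definition col_norm (v : 'cV[A]_k.+1) : R :=
  Num.sqrt (cnorm (\sum_i star (v i ord0) * v i ord0)).

(* The C*-norm of M_(k+1)(A): its operator norm on A^(k+1). *)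
Definition mat_norm (a : matalg A k) : R :=
  sup [set col_norm ((a : 'M[A]_k.+1) *m v) | v in [set v | col_norm v <= 1]].

End MatrixNorm.

(* In this section D stands for a C*-algebra with norm N; it is used with
   (D, N) = (A, cnorm) and (D, N) = (matalg A k, mat_norm). *)
Section CStarNotions.
Variables (R : realType) (D : starAlgType R) (N : D -> R).

Definition positive (x : D) : Prop := exists y : D, x = star y * y.

Definition is_projection (p : D) : Prop := p * p = p /\ star p = p.

Definition cuntz_sub (a b : D) : Prop :=
  exists r : nat -> D,
    (fun i => N (r i * b * star (r i) - a)) @ \oo --> (0 : R).

Definition spectrum (x : D) : set R[i] :=
  [set z | ~ exists y : D, (x - z%:A) * y = 1 /\ y * (x - z%:A) = 1].

(* For self-adjoint x (so that the spectrum is real), c = f(x): the norm limit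
   of p_i(x) for polynomials p_i converging to f uniformly on the spectrum. *)
Definition is_cfc (f : R -> R) (x c : D) : Prop :=
  exists p : nat -> {poly R[i]},
    (forall e : R, 0 < e -> \forall i \near \oo,
       forall z, spectrum x z ->
         complex.Re `|(p i).[z] - (f (complex.Re z))%:C%C| < e) /\
    (fun i => N (horner_alg x (p i) - c)) @ \oo --> (0 : R).

Definition cfc (f : R -> R) (x : D) : D := xget 0 [set c | is_cfc f x c].

Definition cut_down (x : D) (e : R) : D := cfc (fun t => Num.max 0 (t - e)) x.

Definition closed_ideal (I : set D) : Prop :=
  [/\ I 0,
      forall x y, I x -> I y -> I (x + y),
      forall (c : R[i]) x, I x -> I (c *: x),
      forall x y, I x -> I (y * x) /\ I (x * y) &
      forall x, (forall e : R, 0 < e -> exists2 y, I y & N (x - y) < e) -> I x].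

Definition simple_algebra : Prop :=
  forall I : set D, closed_ideal I -> I = [set 0] \/ I = setT.

(* A C*-subalgebra of D is given by a C*-algebra B together with an isometric
   *-homomorphism (not necessarily unital) from B to D. *)
Definition cstar_inclusion (B : cstarType R) (iota : {linear B -> D}) : Prop :=
  [/\ forall x y, iota (x * y) = iota x * iota y,
      forall x, iota (star x) = star (iota x) &
      forall x, N (iota x) = cnorm x].

Definition approx_in (e : R) (x : D) (S : set D) : Prop :=
  exists2 b, S b & N (x - b) < e.

Definition WTA (Omega : cstarType R -> Prop) : Prop :=
  simple_algebra /\
  forall (e : R) (F : seq D) (a : D), 0 < e -> positive a -> a <> 0 ->
  exists (p g : D) (B : cstarType R) (iota : {linear B -> D}),
    [/\ is_projection p,
        positive g /\ positive (1 - g),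
        cstar_inclusion iota /\ Omega B,
        range iota g &
        iota 1 = p] /\
    [/\ forall x, x \in F -> approx_in e ((p - g) * x) (range iota) /\
                             approx_in e (x * (p - g)) (range iota),
        forall x, x \in F -> N ((p - g) * x - x * (p - g)) < e,
        cuntz_sub (1 - (p - g)) a &
        N ((p - g) * a * (p - g)) >= N a - e].

End CStarNotions.

(* Every isometry in every matrix algebra over A is unitary. *)
Definition stably_finite (R : realType) (A : cstarType R) : Prop :=
  forall (k : nat) (v : matalg A k), star v * v = 1 -> v * star v = 1.

Section Divisibility.
Variables (R : realType) (A : cstarType R).

(* Elements of M_oo(A), each given with a matrix size: [Tagged _ a] with
   a : matalg A k. The sizes are identified by [pad] in [minf_cuntz_sub]. *)
Definition minf : Type := {k : nat & matalg A k}.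

Definition minf_mk (k : nat) (a : matalg A k) : minf := existT _ k a.

Definition pad (k l : nat) (a : matalg A k) : matalg A l :=
  \matrix_(i, j) match insub (i : nat), insub (j : nat) with
                 | Some i', Some j' => a i' j'
                 | _, _ => 0
                 end.

Definition minf_positive (a : minf) : Prop := positive (projT2 a).

Definition minf_cuntz_sub (a b : minf) : Prop :=
  let k := maxn (projT1 a) (projT1 b) in
  cuntz_sub (@mat_norm R A k) (pad k (projT2 a)) (pad k (projT2 b)).

Definition minf_dsum (a b : minf) : minf :=
  @minf_mk (projT1 a + (projT1 b).+1)
    (block_mx (projT2 a : 'M[A]_((projT1 a).+1)) 0
              0 (projT2 b : 'M[A]_((projT1 b).+1))).

Definition minf0 : minf := minf_mk (0 : matalg A 0).

Definition minf_sum (n : nat) (x : 'I_n -> minf) : minf :=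
  \big[minf_dsum/minf0]_(j < n) x j.

Definition minf_mul (m : nat) (x : minf) : minf := minf_sum (fun _ : 'I_m => x).

Definition minf_cut_down (a : minf) (e : R) : minf :=
  minf_mk (cut_down (@mat_norm R A (projT1 a)) (projT2 a) e).

Definition weakly_divisible (m n : nat) : Prop :=
  forall (a : minf) (e : R), minf_positive a -> 0 < e ->
  exists x : 'I_n -> minf,
    [/\ forall j, minf_positive (x j),
        forall j, minf_cuntz_sub (minf_mul m (x j)) a &
        minf_cuntz_sub (minf_cut_down a e) (minf_sum x)].

Definition secondly_weakly_divisible (m n : nat) : Prop :=
  forall (a : minf) (e : R), minf_positive a -> 0 < e ->
  exists x : 'I_n -> minf,
    [/\ forall j, minf_positive (x j),
        forall j, minf_cuntz_sub (minf_mul m (x j)) (minf_dsum a a) &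
        minf_cuntz_sub (minf_cut_down a e) (minf_sum x)].

End Divisibility.

(* Main.v *)
Require Import Defs.
From HB Require Import structures.
From mathcomp Require Import all_boot all_order all_algebra.
From mathcomp Require Import complex ring lra zify.
From mathcomp Require Import all_classical all_reals all_analysis.

Set Implicit Arguments.
Unset Strict Implicit.
Unset Printing Implicit Defensive.

Import Order.TTheory GRing.Theory Num.Theory.
Import numFieldNormedType.Exports.

Local Open Scope classical_set_scope.
Local Open Scope ring_scope.

(** The proof combines one approximation step with a trick that produces a
    small divisible element out of the same step.

    Approximation step.  Let a be a positive element of D = M_k(A) and let p, g,
    B witness the tracial approximation of a.  Put h = p - g, so that
    0 <= h <= 1 and h lies in B.  The compression h a h is close to a positive
    element of B, and cutting it down a little gives b in B that is Cuntz below
    h a h, hence below a, with h a h <= b + small.  Weak divisibility of B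
    yields x_1, ..., x_n with m<x_j> <= <b> <= <a> and with a cut-down c of b
    below the sum of the x_j.  On the other hand (2h - 1) a (2h - 1) >= 0 says
    a <= 2 (h a h + (1 - h) a (1 - h)), so that (a - e)_+ is Cuntz below the
    direct sum of c and 1 - h, and 1 - h is Cuntz below any nonzero positive
    element chosen beforehand.

    Absorbing 1 - h.  The step applied once to a itself, with errors small
    against the norm of a, gives x_j that are not all zero: the norm of h a h is
    close to that of a, which keeps c away from zero.  Some nonzero s = x_j thus satisfies
    m<s> <= <a>.  A nonzero positive element of M_k(A) below s bounds 1 - h in a
    second application of the step, with new x_j; replacing x_1 by x_1 + s
    absorbs 1 - h and costs the second copy of <a>.

    All this rests on the elementary theory of positive elements, developed
    from the C*-identity.  Positivity is first taken in the form of Kelley and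
    Vaught (x = x* and the norm of t - x is at most t for some t >= 0), square
    roots come from a fixed-point iteration ([sqrt_core]), and Kaplansky's
    argument shows that every x* x is positive ([nonneg_star_mul]).  The norm of
    a positive element lies in its spectrum ([norm_attained]); this takes the
    place of the spectral radius formula and identifies the continuous
    functional calculus of t |-> max(0, t - e) with an explicit positive part
    ([cut_downP]).  The comparison results are: x <= y implies that x is Cuntz
    below y ([cuntz_le_cle]), and x - e <= z implies that (x - e)_+ is Cuntz
    below z ([cuntz_le_pos_part]).  M_k(A) is a C*-algebra because its norm is
    an operator norm on a Hilbert module, for which the Cauchy-Schwarz
    inequality holds ([cauchy_schwarz]).  Cuntz comparison of matrices of
    different sizes is treated with rectangular r in r b r*, and convergence is
    measured by the sum of the norms of the entries. *)

(** * Elementary facts about C*-algebras *)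

Lemma cvg0P (R : realType) (f : nat -> R) :
  (forall i, 0 <= f i) ->
  (f @ \oo --> (0 : R)) <->
  (forall e : R, 0 < e -> exists n0, forall i, (n0 <= i)%N -> f i < e).
Proof.
move=> f0; split.
  move=> /cvgrPdist_lt h e e0; have [N _ hN] := h _ e0.
  by exists N => i Ni; have := hN i Ni; rewrite sub0r normrN ger0_norm.
move=> h; apply/cvgrPdist_lt => e e0; have [N hN] := h _ e0.
by exists N => // i Ni /=; rewrite sub0r normrN ger0_norm //; apply: hN.
Qed.

Section CStarBasics.
Variables (R : realType) (D : cstarType R).
Implicit Types (x y z : D) (r s t : R).

(** Real scalars as central elements of D: multiplication by a scalar becomes
    a product, so that every computation is an identity in the ring D. *)
Definition sc r : D := (r%:C)%C%:A.

Lemma scD r s : sc (r + s) = sc r + sc s.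
Proof. by rewrite /sc rmorphD scalerDl. Qed.
Lemma scN r : sc (- r) = - sc r.
Proof. by rewrite /sc rmorphN scaleNr. Qed.
Lemma scB r s : sc (r - s) = sc r - sc s.
Proof. by rewrite scD scN. Qed.
Lemma sc0 : sc 0 = 0. Proof. by rewrite /sc rmorph0 scale0r. Qed.
Lemma sc1 : sc 1 = 1. Proof. by rewrite /sc rmorph1 scale1r. Qed.
Lemma scM r s : sc (r * s) = sc r * sc s.
Proof. by rewrite /sc rmorphM -scalerAl mul1r scalerA. Qed.
Lemma mul_scl r x : sc r * x = (r%:C)%C *: x.
Proof. by rewrite /sc -scalerAl mul1r. Qed.
Lemma mul_scr r x : x * sc r = (r%:C)%C *: x.
Proof. by rewrite /sc -scalerAr mulr1. Qed.
Lemma scC r x : x * sc r = sc r * x.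
Proof. by rewrite mul_scl mul_scr. Qed.
Lemma scCA r x y : x * (sc r * y) = sc r * (x * y).
Proof. by rewrite mulrA scC mulrA. Qed.

Lemma star0 : star (0 : D) = 0.
Proof. by apply: (@addrI _ (star 0)); rewrite -starD !addr0. Qed.
Lemma starN x : star (- x) = - star x.
Proof. by apply/eqP; rewrite -addr_eq0 -starD addNr star0. Qed.
Lemma starB x y : star (x - y) = star x - star y.
Proof. by rewrite starD starN. Qed.
Lemma star1 : star (1 : D) = 1.
Proof. by rewrite -[LHS]mulr1 -[X in _ * X]starK -starM mulr1 starK. Qed.
Lemma star_sc r : star (sc r) = sc r.
Proof. by rewrite /sc starZ conjc_real star1. Qed.

Lemma cnorm0 : cnorm (0 : D) = 0.
Proof. by rewrite -(scale0r (0 : D)) cnormZ normr0 mul0r. Qed.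
Lemma cnorm_scM r x : cnorm (sc r * x) = `|r| * cnorm x.
Proof. by rewrite mul_scl cnormZ normc_def /= expr0n addr0 sqrtr_sqr. Qed.
Lemma cnormN x : cnorm (- x) = cnorm x.
Proof. by have := cnorm_scM (-1) x; rewrite scN sc1 mulN1r normrN normr1 mul1r. Qed.
Lemma cnormC x y : cnorm (x - y) = cnorm (y - x).
Proof. by rewrite -cnormN opprB. Qed.
Lemma cnormB x y : cnorm (x - y) <= cnorm x + cnorm y.
Proof. by rewrite -(cnormN y) cnormD. Qed.
Lemma cnorm_ge0 x : 0 <= cnorm x.
Proof.
have := cnormB x x; rewrite subrr cnorm0 -mulr2n => h.
by rewrite -(pmulrn_lge0 _ (n := 2)).
Qed.
Lemma cnorm_tri x y z : cnorm (x - z) <= cnorm (x - y) + cnorm (y - z).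
Proof. by have := cnormD (x - y) (y - z); rewrite addrA subrK. Qed.
(** From the C*-identity, the square of the norm of x is at most the product
    of the norms of x* and x. *)
Lemma cnorm_starE x : cnorm (star x) = cnorm x.
Proof.
suff h y : cnorm y <= cnorm (star y).
  by apply/eqP; rewrite eq_le h andbT -{2}(starK x) h.
have := cnorm_ge0 y; rewrite le_eqVlt => /orP[/eqP <-|y0]; first exact: cnorm_ge0.
by rewrite -(ler_pM2r y0) -expr2 -cnorm_star cnormM.
Qed.
Lemma cnorm1 : cnorm (1 : D) = 1.
Proof.
have := cnorm_star (1 : D); rewrite star1 mulr1 expr2 => /esym/eqP.
rewrite -{3}[cnorm 1]mulr1 -subr_eq0 -mulrBr mulf_eq0 subr_eq0 => /orP[/eqP /cnorm_eq0/eqP|/eqP //].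
by rewrite oner_eq0.
Qed.
Lemma cnorm_sc r : cnorm (sc r) = `|r|.
Proof. by rewrite -[sc r]mulr1 cnorm_scM cnorm1 mulr1. Qed.
Lemma cnorm_mulstar x : cnorm (x * star x) = cnorm x ^+ 2.
Proof. by rewrite -{1}(starK x) cnorm_star cnorm_starE. Qed.
Lemma cnorm_sqr x : star x = x -> cnorm (x * x) = cnorm x ^+ 2.
Proof. by move=> h; rewrite -{1}h cnorm_star. Qed.
Lemma cnorm_le0 x : cnorm x <= 0 -> x = 0.
Proof. by move=> h; apply: cnorm_eq0; apply/eqP; rewrite eq_le h cnorm_ge0. Qed.
Lemma cnorm_small x : (forall e, 0 < e -> cnorm x <= e) -> x = 0.
Proof.
move=> h; apply: cnorm_le0; apply/ler_addgt0Pr => e e0.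
by rewrite add0r h.
Qed.

Definition climit (u : nat -> D) (l : D) :=
  forall e, 0 < e -> exists n0, forall i, (n0 <= i)%N -> cnorm (u i - l) < e.

Lemma cauchy_climit (u : nat -> D) :
  (forall e, 0 < e -> exists n0, forall i j,
     (n0 <= i)%N -> (i <= j)%N -> cnorm (u j - u i) < e) ->
  exists l, climit u l.
Proof.
move=> h; have [|l /cvg0P hl] := @cnorm_complete _ D u.
  move=> e e0; have [n0 hn] := h e e0; exists n0 => i j ni nj.
  by have [ij|/ltnW ij] := leqP i j; [rewrite cnormC|]; apply: hn.
by exists l => e e0; apply: hl => // i; apply: cnorm_ge0.
Qed.

Definition invertible x := exists y, x * y = 1 /\ y * x = 1.

Lemma invertibleP x y z : x * y = 1 -> z * x = 1 -> invertible x.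
Proof.
move=> xy zx; exists y; split=> //.
by rewrite -[y]mul1r -zx -(mulrA z) xy mulr1.
Qed.

Lemma invertibleM x y : invertible x -> invertible y -> invertible (x * y).
Proof.
move=> [x' [h1 h2]] [y' [h3 h4]]; exists (y' * x'); split.
  by rewrite -mulrA (mulrA y) h3 mul1r.
by rewrite -mulrA (mulrA x') h2 mul1r.
Qed.

Lemma invertible_comm_mull x y : x * y = y * x -> invertible (x * y) -> invertible x.
Proof.
move=> c [z [h1 h2]]; apply: (@invertibleP x (y * z) (z * y)); first by rewrite mulrA.
by rewrite -mulrA -c.
Qed.

Lemma comm_inv x y z : x * y = 1 -> y * x = 1 -> z * x = x * z -> z * y = y * z.
Proof.
move=> h1 h2 h; rewrite -[LHS]mul1r -h2 -(mulrA y) (mulrA x) -h.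
by rewrite -(mulrA z) h1 mulr1.
Qed.

Lemma inv_unique x y z : x * y = 1 -> z * x = 1 -> y = z.
Proof. by move=> xy zx; rewrite -[y]mul1r -zx -mulrA xy mulr1. Qed.

Lemma invertible_sc r : r != 0 -> invertible (sc r).
Proof.
by move=> r0; exists (sc r^-1); rewrite -!scM mulVf // mulfV // sc1.
Qed.

Lemma neumann z : cnorm z < 1 -> invertible (1 - z).
Proof.
move=> z1; have z0 := cnorm_ge0 z.
pose u n := \sum_(i < n) z ^+ i.
have hX n : cnorm (z ^+ n) <= cnorm z ^+ n.
  elim: n => [|n IH]; first by rewrite !expr0 cnorm1.
  by rewrite !exprS (le_trans (cnormM _ _)) // ler_wpM2l.
have uS n : u n.+1 = u n + z ^+ n by rewrite /u big_ord_recr.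
have hu n : (1 - z) * u n = 1 - z ^+ n.
  by rewrite -[RHS]opprB subrX1 -mulNr opprB.
have hu' n : u n * (1 - z) = 1 - z ^+ n.
  by rewrite -hu /u mulr_suml mulr_sumr; apply: eq_bigr => i _;
     rewrite mulrBl mulrBr mul1r mulr1 -exprS -exprSr.
have hd n k : cnorm (u (k + n)%N - u n) * (1 - cnorm z) <= cnorm z ^+ n.
  have h : cnorm (u (k + n)%N - u n) * (1 - cnorm z) <= cnorm z ^+ n - cnorm z ^+ (k + n).
    elim: k => [|k IH]; first by rewrite add0n !subrr cnorm0 mul0r.
    rewrite addSn uS addrAC.
    apply: (@le_trans _ _ ((cnorm (u (k + n)%N - u n) + cnorm z ^+ (k + n)) * (1 - cnorm z))).
      apply: ler_wpM2r; first by rewrite subr_ge0 ltW.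
      by apply: le_trans (cnormD _ _) _; rewrite lerD2l.
    by rewrite mulrDl (exprS _ (k + n)); lra.
  by apply: le_trans h _; rewrite gerBl exprn_ge0.
have pow_small e : 0 < e -> exists n0, forall i, (n0 <= i)%N -> cnorm z ^+ i < e.
  apply: (proj1 (cvg0P _)); first by move=> i; apply: exprn_ge0.
  by apply: cvg_expr; rewrite ger0_norm.
have [|w hw] := @cauchy_climit u.
  move=> e e0; have [|n0 hn0] := pow_small (e * (1 - cnorm z)).
    by rewrite mulr_gt0 // subr_gt0.
  exists n0 => i j ni ij; rewrite -(subnK ij).
  have := hd i (j - i)%N; have := hn0 i ni => h1 h2.
  by rewrite -(@ltr_pM2r _ (1 - cnorm z)) ?subr_gt0 //; apply: le_lt_trans h2 h1.
have key (v : nat -> D) (l : D) : (forall n, v n = 1 - z ^+ n) ->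
    (forall n, cnorm (v n - l) <= cnorm (1 - z) * cnorm (u n - w)) -> l = 1.
  move=> hv hl; apply/eqP; rewrite -subr_eq0; apply/eqP/cnorm_small => e e0.
  have e2 : 0 < e / 2 by lra.
  have q0 : 0 < cnorm (1 - z) + 1 by rewrite ltr_wpDl // cnorm_ge0.
  have [n1 h1] := pow_small _ e2.
  have [|n2 h2] := hw (e / 2 / (cnorm (1 - z) + 1)); first by rewrite divr_gt0.
  pose n := maxn n1 n2.
  have := hl n; rewrite cnormC => hl'.
  apply: le_trans (cnorm_tri _ (v n) _) _; rewrite {2}hv addrAC subrr add0r cnormN.
  have := hX n; have := h1 n (leq_maxl _ _); have := h2 n (leq_maxr _ _).
  rewrite ltr_pdivlMr // => h3; have := cnorm_ge0 (u n - w); lra.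
exists w; split.
  apply: (key (fun n => (1 - z) * u n)); first exact: hu.
  by move=> n /=; rewrite -mulrBr cnormM.
apply: (key (fun n => u n * (1 - z))); first exact: hu'.
by move=> n /=; rewrite -mulrBl mulrC cnormM.
Qed.

Definition iu : D := ('i)%C%:A.

Lemma iuC x : x * iu = iu * x.
Proof. by rewrite /iu -scalerAr -scalerAl mulr1 mul1r. Qed.
Lemma iu_sqr : iu * iu = -1.
Proof. by rewrite /iu -scalerAl mul1r scalerA -expr2 sqr_i scaleN1r. Qed.
Lemma star_iu : star iu = - iu.
Proof. by rewrite /iu starZ star1 -scaleNr; congr (_ *: _); simpc. Qed.

End CStarBasics.
#[global] Hint Extern 0 (is_true (0 <= cnorm _)) => solve [exact: cnorm_ge0] : core.

(** * Ring identities with central elements, by reflection *)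

(** An identity e1 = e2 is decided by expanding e1 - e2 into signed monomials
    and cancelling them in pairs.  A monomial is a sign (true for minus), a
    sorted list of central factors and a list of the other factors in order. *)
Inductive ncexpr := NCatom of nat | NCscal of nat | NCzero | NCone
  | NCadd of ncexpr & ncexpr | NCopp of ncexpr | NCmul of ncexpr & ncexpr.

Definition ncmon := (bool * (seq nat * seq nat))%type.

Fixpoint nc_insert (i : nat) (s : seq nat) :=
  if s is j :: s' then if (i <= j)%N then i :: s else j :: nc_insert i s'
  else [:: i].

Definition ncmon_mul (t u : ncmon) : ncmon :=
  (t.1 (+) u.1, (foldr nc_insert u.2.1 t.2.1, t.2.2 ++ u.2.2)).

Fixpoint nc_norm (e : ncexpr) : seq ncmon :=
  match e with
  | NCatom i => [:: (false, ([::], [:: i]))]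
  | NCscal i => [:: (false, ([:: i], [::]))]
  | NCzero => [::]
  | NCone => [:: (false, ([::], [::]))]
  | NCadd a b => nc_norm a ++ nc_norm b
  | NCopp a => [seq (~~ t.1, t.2) | t <- nc_norm a]
  | NCmul a b => [seq ncmon_mul t u | t <- nc_norm a, u <- nc_norm b]
  end.

Fixpoint nc_cancel (n : nat) (s : seq ncmon) : bool :=
  match s, n with
  | [::], _ => true
  | t :: s', n'.+1 =>
      let t' : ncmon := (~~ t.1, t.2) in (t' \in s') && nc_cancel n' (rem t' s')
  | _, _ => false
  end.

Definition nc_check e1 e2 :=
  let s := nc_norm (NCadd e1 (NCopp e2)) in nc_cancel (size s) s.

Section NoncommutativeRing.
Variables (D : pzRingType) (S : Type) (phi : S -> D) (s0 : S).
Hypothesis phiC : forall s x, x * phi s = phi s * x.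
Variables (va : seq D) (vs : seq S).

Fixpoint nc_eval (e : ncexpr) : D :=
  match e with
  | NCatom i => nth 0 va i
  | NCscal i => phi (nth s0 vs i)
  | NCzero => 0
  | NCone => 1
  | NCadd a b => nc_eval a + nc_eval b
  | NCopp a => - nc_eval a
  | NCmul a b => nc_eval a * nc_eval b
  end.

Let evs (s : seq nat) : D := foldr (fun i x => phi (nth s0 vs i) * x) 1 s.
Let eva (s : seq nat) : D := foldr (fun i x => nth 0 va i * x) 1 s.
Let evm (t : ncmon) : D := (-1) ^+ t.1 * (evs t.2.1 * eva t.2.2).

Let evs_insert i s : evs (nc_insert i s) = phi (nth s0 vs i) * evs s.
Proof.
elim: s => //= j s IH; case: ifP => // _.
by rewrite /= IH !mulrA phiC.
Qed.

Let evs_merge s s' : evs (foldr nc_insert s' s) = evs s * evs s'.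
Proof. by elim: s => [|i s IH] /=; rewrite ?mul1r // evs_insert IH mulrA. Qed.

Let eva_cat s s' : eva (s ++ s') = eva s * eva s'.
Proof. by elim: s => [|i s IH] /=; rewrite ?mul1r // IH mulrA. Qed.

Let evs_comm x s : x * evs s = evs s * x.
Proof.
elim: s => [|i s IH] /=; first by rewrite mulr1 mul1r.
by rewrite mulrA phiC -mulrA IH mulrA.
Qed.

Let evm_mul t u : evm (ncmon_mul t u) = evm t * evm u.
Proof.
have core a b a' b' : evs a * evs b * (eva a' * eva b') =
    evs a * eva a' * (evs b * eva b').
  by rewrite -!mulrA; congr (_ * _); rewrite !mulrA evs_comm.
case: t u => [[] [a a']] [[] [b b']];
  rewrite /evm /= evs_merge eva_cat core ?expr0 ?expr1;
  by rewrite ?mulN1r ?mul1r ?mulNr ?mulrN ?opprK.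
Qed.

Let evm_neg t : evm (~~ t.1, t.2) = - evm t.
Proof. by rewrite /evm /= signrN mulNr. Qed.

Let nc_norm_eval e : nc_eval e = \sum_(t <- nc_norm e) evm t.
Proof.
elim: e => [i|i|||a IHa b IHb|a IHa|a IHa b IHb] /=.
- by rewrite big_seq1 /evm /= mul1r mul1r mulr1.
- by rewrite big_seq1 /evm /= mul1r !mulr1.
- by rewrite big_nil.
- by rewrite big_seq1 /evm /= !mulr1.
- by rewrite big_cat IHa IHb.
- by rewrite big_map IHa -sumrN; apply: eq_bigr => t _; rewrite evm_neg.
- rewrite big_allpairs_dep IHa IHb mulr_suml; apply: eq_bigr => t _.
  by rewrite mulr_sumr; apply: eq_bigr => u _; rewrite evm_mul.
Qed.

Lemma nc_cancelP n s : nc_cancel n s -> \sum_(t <- s) evm t = 0.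
Proof.
elim: n s => [|n IH] [|t s] //=; rewrite ?big_nil //.
case/andP => ts /IH h; rewrite big_cons (perm_big _ (perm_to_rem ts)) big_cons.
by rewrite evm_neg addrA subrr add0r h.
Qed.

Lemma nc_checkP e1 e2 : nc_check e1 e2 -> nc_eval e1 = nc_eval e2.
Proof.
by move=> /nc_cancelP h; apply/eqP; rewrite -subr_eq0 -h -nc_norm_eval.
Qed.

End NoncommutativeRing.

Ltac nc_find a l :=
  lazymatch l with
  | cons ?b ?l' => match constr:(tt) with
                   | _ => let _ := match goal with _ => constr_eq a b end in constr:(0%N)
                   | _ => let n := nc_find a l' in constr:(n.+1)
                   end
  end.

Ltac nc_add a l :=
  match constr:(tt) with
  | _ => let n := nc_find a l in constr:(l)
  | _ => lazymatch l with
         | nil => constr:([:: a])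
         | cons ?b ?l' => let l2 := nc_add a l' in constr:(b :: l2)
         end
  end.

Ltac nc_atoms va t :=
  lazymatch t with
  | @Algebra.add _ ?a ?b => let v := nc_atoms va a in nc_atoms v b
  | @GRing.mul _ ?a ?b => let v := nc_atoms va a in nc_atoms v b
  | @Algebra.opp _ ?a => nc_atoms va a
  | @Algebra.zero _ => va
  | @GRing.one _ => va
  | @sc _ _ _ => va
  | _ => nc_add t va
  end.

Ltac nc_scals vs t :=
  lazymatch t with
  | @Algebra.add _ ?a ?b => let v := nc_scals vs a in nc_scals v b
  | @GRing.mul _ ?a ?b => let v := nc_scals vs a in nc_scals v b
  | @Algebra.opp _ ?a => nc_scals vs a
  | @sc _ _ ?r => nc_add r vs
  | _ => vs
  end.

Ltac nc_reify va vs t :=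
  lazymatch t with
  | @Algebra.add _ ?a ?b =>
      let x := nc_reify va vs a in let y := nc_reify va vs b in constr:(NCadd x y)
  | @GRing.mul _ ?a ?b =>
      let x := nc_reify va vs a in let y := nc_reify va vs b in constr:(NCmul x y)
  | @Algebra.opp _ ?a => let x := nc_reify va vs a in constr:(NCopp x)
  | @Algebra.zero _ => constr:(NCzero)
  | @GRing.one _ => constr:(NCone)
  | @sc _ _ ?r => let n := nc_find r vs in constr:(NCscal n)
  | _ => let n := nc_find t va in constr:(NCatom n)
  end.

(** Central elements are recognised by the shape [sc r]; every other subterm
    that is not a sum, a product or an opposite is an atom. *)
Ltac nc D :=
  lazymatch goal with
  | |- ?a = ?b =>
    lazymatch type of D with
    | CStarAlgebra.type ?R =>
      let va := nc_atoms (@nil (CStarAlgebra.sort D)) a in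
      let va := nc_atoms va b in
      let vs := nc_scals (@nil (Real.sort R)) a in
      let vs := nc_scals vs b in
      let ea := nc_reify va vs a in
      let eb := nc_reify va vs b in
      exact: (@nc_checkP D R (@sc R D) 0 (@scC R D) va vs ea eb erefl)
    end
  end.

(** * Square roots *)

Section SqrtIteration.
Variable R : realType.

(** The element 1 - sqrt (1 - z) is the fixed point of w |-> (z + w^2) / 2.
    Started at 0, the iterates are polynomials in z with nonnegative
    coefficients, so for z in the unit ball they and their increments are
    bounded by those of this scalar iteration at z = 1, which increases to 1. *)
Fixpoint root_seq (n : nat) : R := if n is k.+1 then (1 + root_seq k ^+ 2) / 2 else 0.

Lemma root_seq_ge0 n : 0 <= root_seq n.
Proof. by case: n => //= n; rewrite divr_ge0 // addr_ge0 // sqr_ge0. Qed.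

(** The gap d = 1 - root_seq n obeys d |-> d - d^2 / 2, which increases on
    [0, 1] and sends 2 / (n + 2) below 2 / (n + 3). *)
Lemma root_seq_gap n : 0 <= 1 - root_seq n <= 2 / n.+2%:R.
Proof.
elim: n => [|n /andP[IH0 IH]].
  by rewrite /= subr0 ler01 divff ?lexx ?pnatr_eq0.
have -> : 1 - root_seq n.+1 = (1 - root_seq n) - (1 - root_seq n) ^+ 2 / 2 by rewrite /=; field.
have := root_seq_ge0 n; set d := 1 - root_seq n in IH0 IH *; move=> s0.
have d1 : d <= 1 by rewrite /d; lra.
apply/andP; split; first by rewrite expr2; nra.
pose q : R := n.+2%:R; have q2 : 2 <= q by rewrite ler_nat.
have q0 : 0 < q by lra.
have -> : n.+3%:R = q + 1 :> R by rewrite -natr1.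
apply: (@le_trans _ _ (2 / q - (2 / q) ^+ 2 / 2)).
  have q1 : 2 / q <= 1 by rewrite ler_pdivrMr // mul1r.
  rewrite -subr_ge0; rewrite -/q in IH; set k := 2 / q in IH q1 *.
  have -> : k - k ^+ 2 / 2 - (d - d ^+ 2 / 2) = (k - d) * (1 - (k + d) / 2) by field.
  by apply: mulr_ge0; lra.
rewrite -subr_ge0.
have -> : 2 / (q + 1) - (2 / q - (2 / q) ^+ 2 / 2) = 2 / (q ^+ 2 * (q + 1)).
  by field; apply/andP; split; apply/eqP; lra.
by rewrite divr_ge0 // mulr_ge0 ?sqr_ge0 //; lra.
Qed.

Lemma root_seq_le1 n : root_seq n <= 1.
Proof. by have /andP[+ _] := root_seq_gap n; rewrite subr_ge0. Qed.

Lemma root_seq_small (e : R) : 0 < e -> exists n0, forall i, (n0 <= i)%N -> 1 - root_seq i < e.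
Proof.
move=> e0; have [n hn] : exists n : nat, 2 / e < n%:R.
  by exists (Num.truncn (2 / e)).+1; rewrite truncnS_gt.
exists n => i ni; have /andP[_ h] := root_seq_gap i; apply: le_lt_trans h _.
rewrite ltr_pdivrMr ?ltr0n // mulrC -ltr_pdivrMr //; apply: lt_le_trans hn _.
by rewrite ler_nat; apply: leq_trans ni _; rewrite -addn2 leq_addr.
Qed.

Definition half_c : R[i] := ((2^-1 : R)%:C)%C.

Fixpoint root_poly (n : nat) : {poly R[i]} :=
  if n is k.+1 then half_c%:P * ('X + root_poly k * root_poly k) else 0.

End SqrtIteration.

Section SquareRoot.
Variables (R : realType) (D : cstarType R).
Implicit Types (x y z b c : D) (r s t : R).
Local Notation sc := (@sc R D).

Lemma comm_horner c z (p : {poly R[i]}) : c * z = z * c ->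
  c * horner_alg z p = horner_alg z p * c.
Proof.
move=> h; elim/poly_ind: p => [|p a IH]; first by rewrite rmorph0 mulr0 mul0r.
rewrite rmorphD rmorphM /= horner_algX horner_algC mulrDr mulrDl mulrA IH.
by rewrite -!mulrA h -scalerAl mul1r -scalerAr mulr1.
Qed.

Definition root_alg z n : D := horner_alg z (root_poly R n).

Lemma root_alg0 z : root_alg z 0 = 0. Proof. by rewrite /root_alg rmorph0. Qed.
Lemma root_algS z n : root_alg z n.+1 = sc 2^-1 * (z + root_alg z n * root_alg z n).
Proof. by rewrite /root_alg /= rmorphM /= horner_algC rmorphD rmorphM /= horner_algX. Qed.

Lemma sc_half_double x : sc 2^-1 * (x + x) = x.
Proof. by rewrite mulrDr -mulrDl -scD (_ : 2^-1 + 2^-1 = 1) ?sc1 ?mul1r //; field. Qed.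

Lemma star_root_alg z n : star z = z -> star (root_alg z n) = root_alg z n.
Proof.
move=> h; elim: n => [|n IH]; first by rewrite root_alg0 star0.
by rewrite root_algS starM star_sc starD starM IH h scC.
Qed.

Lemma root_alg_norm z n : cnorm z <= 1 -> cnorm (root_alg z n) <= root_seq R n.
Proof.
move=> h; elim: n => [|n IH]; first by rewrite root_alg0 cnorm0.
rewrite root_algS cnorm_scM /= ger0_norm ?invr_ge0 // [in leRHS]mulrC ler_pM2l ?invr_gt0 //.
apply: le_trans (cnormD _ _) _; apply: lerD => //.
by apply: le_trans (cnormM _ _) _; rewrite expr2; apply: ler_pM.
Qed.

Lemma cnorm_sqB x y : cnorm (x * x - y * y) <= cnorm (x - y) * (cnorm x + cnorm y).
Proof.
have -> : x * x - y * y = x * (x - y) + (x - y) * y by nc D.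
apply: le_trans (cnormD _ _) _; rewrite [leRHS]mulrDr; apply: lerD.
  by rewrite [leRHS]mulrC cnormM.
exact: cnormM.
Qed.

Lemma root_alg_diff z n x : root_alg z n.+1 - sc 2^-1 * (z + x * x) =
  sc 2^-1 * (root_alg z n * root_alg z n - x * x).
Proof. by rewrite root_algS; nc D. Qed.

Lemma root_alg_step z n : cnorm z <= 1 ->
  cnorm (root_alg z n.+1 - root_alg z n) <= root_seq R n.+1 - root_seq R n.
Proof.
move=> h; elim: n => [|n IH].
  rewrite root_algS root_alg0 subr0 mulr0 addr0 cnorm_scM /= ger0_norm ?invr_ge0 //.
  by rewrite expr0n addr0 subr0 mulrC; apply: ler_wpM2r; rewrite ?invr_ge0.
rewrite [X in _ - X]root_algS root_alg_diff cnorm_scM ger0_norm ?invr_ge0 //.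
have -> : root_seq R n.+2 - root_seq R n.+1 =
  2^-1 * ((root_seq R n.+1 - root_seq R n) * (root_seq R n.+1 + root_seq R n)) by rewrite /=; field.
rewrite ler_pM2l ?invr_gt0 //; apply: le_trans (cnorm_sqB _ _) _.
apply: ler_pM => //; first by rewrite addr_ge0.
by apply: lerD; apply: root_alg_norm.
Qed.

Lemma root_alg_tele z n k : cnorm z <= 1 ->
  cnorm (root_alg z (k + n) - root_alg z n) <= root_seq R (k + n) - root_seq R n.
Proof.
move=> h; elim: k => [|k IH]; first by rewrite !subrr cnorm0.
apply: le_trans (cnorm_tri _ (root_alg z (k + n)) _) _.
by have := @root_alg_step z (k + n) h; rewrite addSn; lra.
Qed.

(** Limits of the iteration are all taken against the rate 1 - root_seq n. *)
Lemma root_seq_small_eq0 x K : 0 <= K -> (forall n, cnorm x <= K * (1 - root_seq R n)) -> x = 0.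
Proof.
move=> K0 ha; apply: cnorm_small => e e0.
have K1 : 0 < K + 1 by lra.
have [n hn] := @root_seq_small R (e / (K + 1)) (divr_gt0 e0 K1).
have := hn n (leqnn n); rewrite ltr_pdivlMr // => h1.
by apply: le_trans (ha n) _; have := root_seq_le1 R n; nra.
Qed.

(** The increments of the iterates are dominated by those of a convergent
    scalar sequence, so the iterates converge, with an explicit rate; the
    fixed-point equation of the limit is (1 - w)^2 = 1 - z.  What commutes with
    z commutes with the iterates, hence with w. *)
Lemma sqrt_core z : star z = z -> cnorm z <= 1 -> exists w,
  [/\ star w = w, cnorm w <= 1, (1 - w) * (1 - w) = 1 - z,
      forall n, cnorm (root_alg z n - w) <= 1 - root_seq R n &
      forall c, c * z = z * c -> c * w = w * c].
Proof.
move=> hz h.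
have [|w hw] := @cauchy_climit _ _ (root_alg z).
  move=> e e0; have [n0 hn] := @root_seq_small R e e0; exists n0 => i j ni ij.
  rewrite -(subnK ij); apply: le_lt_trans (root_alg_tele _ _ h) _.
  by have := hn i ni; have := root_seq_le1 R (j - i + i); lra.
have hd n : cnorm (root_alg z n - w) <= 1 - root_seq R n.
  apply/ler_addgt0Pr => e e0; have [n0 hn] := hw e e0.
  pose k := maxn n n0.
  have := hn k (leq_maxr _ _); have := cnorm_tri (root_alg z n) (root_alg z k) w.
  have := @root_alg_tele z n (k - n) h; rewrite subnK ?leq_maxl // (cnormC (root_alg z k)).
  by have := root_seq_le1 R k; lra.
have hw1 : cnorm w <= 1 by have := hd 0%N; rewrite root_alg0 sub0r cnormN /= subr0.
have heq : w = sc 2^-1 * (z + w * w).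
  apply/eqP; rewrite -subr_eq0; apply/eqP/(@root_seq_small_eq0 _ 2) => // n.
  apply: le_trans (cnorm_tri _ (root_alg z n.+1) _) _; rewrite cnormC.
  have h1 := hd n.+1.
  have h2 : cnorm (root_alg z n.+1 - sc 2^-1 * (z + w * w)) <= 1 - root_seq R n.
    rewrite root_alg_diff cnorm_scM ger0_norm ?invr_ge0 //.
    have := cnorm_sqB (root_alg z n) w; have := root_alg_norm n h; have := hd n.
    have := root_seq_le1 R n; have := cnorm_ge0 (root_alg z n - w); have := cnorm_ge0 (root_alg z n).
    set p := cnorm (_ * _ - _); set q := cnorm (_ - _); set u := cnorm (root_alg z n).
    move=> u0 q0 s1 qs us pq; have w0 := cnorm_ge0 w.
    have : q * (u + cnorm w) <= (1 - root_seq R n) * 2 by apply: ler_pM; lra.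
    lra.
  have h3 : 1 - root_seq R n.+1 <= 1 - root_seq R n.
    by rewrite /=; have := sqr_ge0 (1 - root_seq R n); rewrite expr2; lra.
  lra.
exists w; split => //.
- apply/eqP; rewrite -subr_eq0; apply/eqP/(@root_seq_small_eq0 _ 2) => // n.
  apply: le_trans (cnorm_tri _ (root_alg z n) _) _.
  rewrite -{1}(star_root_alg n hz) -starB cnorm_starE cnormC; have := hd n; lra.
- have h2 : w + w = z + w * w.
    by rewrite {1 2}heq -mulrDr sc_half_double.
  have -> : (1 - w) * (1 - w) = 1 - (w + w) + w * w by nc D.
  by rewrite h2; nc D.
- move=> c hc; apply/eqP; rewrite -subr_eq0; apply/eqP.
  apply: (@root_seq_small_eq0 _ (cnorm c *+ 2)); first by rewrite mulrn_wge0.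
  move=> n; have -> : c * w - w * c = (root_alg z n - w) * c - c * (root_alg z n - w).
    have hy : c * root_alg z n = root_alg z n * c := comm_horner _ hc.
    by rewrite mulrBl mulrBr hy; nc D.
  apply: le_trans (cnormB _ _) _.
  have h1 := hd n; rewrite mulr2n [leRHS]mulrDl; apply: lerD.
    by rewrite [leRHS]mulrC; apply: le_trans (cnormM _ _) _; apply: ler_wpM2r.
  by apply: le_trans (cnormM _ _) _; apply: ler_wpM2l.
Qed.
End SquareRoot.

(** * Positive elements *)

Section Positivity.
Variables (R : realType) (D : cstarType R).
Implicit Types (x y z a b c : D) (r s t : R).
Local Notation sc := (@sc R D).

(** The Kelley-Vaught form of positivity.  It is visibly stable under sums,
    which is the difficult point for elements of the form y* y; the two notions
    agree by [positiveP]. *)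
Definition nonneg x := star x = x /\ exists2 t, 0 <= t & cnorm (sc t - x) <= t.

Lemma nonneg_star x : nonneg x -> star x = x. Proof. by case. Qed.

Lemma nonnegD x y : nonneg x -> nonneg y -> nonneg (x + y).
Proof.
move=> [hx [t t0 ht]] [hy [s s0 hs]]; split; first by rewrite starD hx hy.
exists (t + s); first exact: addr_ge0.
have -> : sc (t + s) - (x + y) = (sc t - x) + (sc s - y) by rewrite scD; nc D.
by apply: le_trans (cnormD _ _) _; apply: lerD.
Qed.

Lemma nonneg_scM r x : 0 <= r -> nonneg x -> nonneg (sc r * x).
Proof.
move=> r0 [hx [t t0 ht]]; split; first by rewrite starM star_sc hx scC.
exists (r * t); first exact: mulr_ge0.
have -> : sc (r * t) - sc r * x = sc r * (sc t - x) by rewrite scM; nc D.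
by rewrite cnorm_scM ger0_norm // ler_wpM2l.
Qed.

Lemma nonneg0 : nonneg 0.
Proof. by split; rewrite ?star0 //; exists 0; rewrite // sc0 subr0 cnorm0. Qed.

Lemma nonneg_sc r : 0 <= r -> nonneg (sc r).
Proof. by move=> r0; split; rewrite ?star_sc //; exists r; rewrite // subrr cnorm0. Qed.

Lemma nonneg_scI r : nonneg (sc r) -> 0 <= r.
Proof. by move=> [_ [t t0]]; rewrite -scB cnorm_sc => /ler_normlP[_]; lra. Qed.

Lemma nonneg_gap x r : star x = x -> cnorm x <= r -> nonneg (sc r - x).
Proof.
move=> hx xr; have r0 : 0 <= r by apply: le_trans xr.
split; first by rewrite starB star_sc hx.
by exists r => //; rewrite opprB addrC subrK.
Qed.

(** If t - x has norm at most t then z = 1 - x / t is in the unit ball, and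
    the square root of x is sqrt t times that of 1 - z. *)
Lemma sqrtP x : nonneg x -> exists y,
  [/\ star y = y, nonneg y, y * y = x & forall c, c * x = x * c -> c * y = y * c].
Proof.
move=> [hx [t + ht]]; rewrite le_eqVlt => /orP[/eqP t0|t0].
  have x0 : x = 0.
    by apply: cnorm_le0; move: ht; rewrite -t0 sc0 sub0r cnormN.
  exists 0; split; rewrite ?star0 ?mul0r //; first exact: nonneg0.
  by move=> c _; rewrite mulr0 mul0r.
pose z := 1 - sc t^-1 * x.
have hz : star z = z by rewrite starB star1 starM star_sc hx scC.
have tt : sc t * sc t^-1 = 1 by rewrite -scM mulfV ?sc1 // gt_eqF.
have hz1 : cnorm z <= 1.
  rewrite -(ler_pM2l t0) mulr1 -{1}[t]gtr0_norm // -cnorm_scM.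
  by rewrite /z mulrBr mulr1 mulrA tt mul1r.
have [w [hw w1 ww _ wc]] := sqrt_core hz hz1.
have s0 : 0 <= Num.sqrt t by rewrite sqrtr_ge0.
exists (sc (Num.sqrt t) * (1 - w)); split.
- by rewrite starM star_sc starB star1 hw scC.
- apply: nonneg_scM => //; split; first by rewrite starB star1 hw.
  by exists 1 => //; rewrite sc1 opprB addrC subrK.
- have -> : sc (Num.sqrt t) * (1 - w) * (sc (Num.sqrt t) * (1 - w)) =
     sc (Num.sqrt t) * sc (Num.sqrt t) * ((1 - w) * (1 - w)) by nc D.
  rewrite ww -scM -expr2 sqr_sqrtr 1?ltW //.
  have -> : 1 - z = sc t^-1 * x by rewrite /z; nc D.
  by rewrite mulrA tt mul1r.
- move=> c hc; rewrite mulrA scC -!mulrA; congr (_ * _).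
  rewrite mulrBr mulrBl mulr1 mul1r wc // /z mulrBr mulrBl mulr1 mul1r.
  by rewrite mulrA scC -!mulrA hc.
Qed.

(** The product of y + iz with its adjoint is y^2 + z^2, so the C*-identity
    computes the norm of y + iz, and y is its real part. *)
Lemma circle_norm y z r : star y = y -> star z = z -> y * z = z * y ->
  y * y + z * z = sc r -> cnorm y ^+ 2 <= `|r|.
Proof.
move=> hy hz hc hr; pose J := iu D.
have JC : forall x, x * J = J * x := @iuC _ D.
have JJ : J * J = -1 := iu_sqr D.
have Js : star J = - J := star_iu D.
pose U := y + J * z.
have hU : star U = y - J * z by rewrite starD starM hy hz Js mulrN JC.
have hn : cnorm U ^+ 2 = `|r|.
  rewrite -cnorm_star hU -(@cnorm_sc _ D) -hr; congr cnorm.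
  have -> : (y - J * z) * U = y * y + (y * J) * z - J * (z * y) - J * (z * J) * z.
    by rewrite /U; nc D.
  rewrite !JC -hc.
  have -> : J * (J * z) * z = (J * J) * (z * z) by nc D.
  by rewrite JJ; nc D.
have : cnorm y <= cnorm U.
  have -> : y = sc 2^-1 * (U + star U).
    by rewrite hU /U -[LHS]sc_half_double; congr (_ * _); nc D.
  rewrite cnorm_scM ger0_norm ?invr_ge0 //.
  by have := cnormD U (star U); rewrite cnorm_starE; lra.
by rewrite -hn => h; rewrite ler_sqr ?nnegrE.
Qed.

(** The square root of 1 - y^2 lies with y on the unit circle, so it belongs
    to the unit ball, and so does its square. *)
Lemma sq_le1 y : star y = y -> cnorm y <= 1 -> cnorm (1 - y * y) <= 1.
Proof.
move=> hy y1.
have [|| w [hw w1 ww _ wc]] := @sqrt_core _ _ (y * y); first by rewrite starM hy.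
  by rewrite cnorm_sqr // expr_le1.
have := @circle_norm (1 - w) y 1; rewrite normr1 -ww => h.
rewrite cnorm_sqr; last by rewrite starB star1 hw.
apply: h => //; first by rewrite starB star1 hw.
  by rewrite mulrBl mulrBr mul1r mulr1 wc // mulrA.
by rewrite ww sc1; nc D.
Qed.

Lemma nonneg_sq y : star y = y -> nonneg (y * y).
Proof.
move=> hy; split; first by rewrite starM hy.
have [->|y0] := eqVneq y 0; first by exists 0; rewrite // sc0 mulr0 subrr cnorm0.
have n0 : 0 < cnorm y.
  by rewrite lt_def cnorm_ge0 andbT; apply: contra_neq y0 => /cnorm_eq0.
exists (cnorm y ^+ 2); first exact: sqr_ge0.
set r := cnorm y in n0 *.
have rr : sc r * sc r^-1 = 1 by rewrite -scM mulfV ?sc1 // gt_eqF.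
have h : cnorm (1 - (sc r^-1 * y) * (sc r^-1 * y)) <= 1.
  apply: sq_le1; first by rewrite starM star_sc hy scC.
  by rewrite cnorm_scM gtr0_norm ?invr_gt0 // -/r mulVf ?lexx // gt_eqF.
have -> : sc (r ^+ 2) - y * y = sc (r ^+ 2) * (1 - (sc r^-1 * y) * (sc r^-1 * y)).
  have -> : sc (r ^+ 2) * (1 - (sc r^-1 * y) * (sc r^-1 * y)) =
     sc (r ^+ 2) - (sc (r ^+ 2) * (sc r^-1 * sc r^-1)) * (y * y) by nc D.
  by rewrite -!scM expr2 -mulrA (mulrA r r^-1) mulfV ?gt_eqF // mul1r mulfV ?gt_eqF // sc1 mul1r.
by rewrite cnorm_scM ger0_norm ?sqr_ge0 // ler_piMr ?sqr_ge0.
Qed.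

(** Write x = y^2 and r - x = z^2; the roots commute and lie on a circle of
    radius sqrt r. *)
Lemma nonneg_norm_le x r : 0 <= r -> nonneg x -> nonneg (sc r - x) -> cnorm x <= r.
Proof.
move=> r0 hx /sqrtP[z [hz _ zz zc]].
have [y [hy _ yy yc]] := sqrtP hx.
rewrite -[r]ger0_norm // -yy cnorm_sqr //; apply: (@circle_norm y z) => //.
  by apply: zc; rewrite mulrBr mulrBl scC -(yc x).
by rewrite yy zz; nc D.
Qed.

(** Factor b + t = (s + t) (1 - (s - b) / (s + t)), where s - b has norm at
    most s: the second factor is invertible by the Neumann series. *)
Lemma invertible_nonnegD b t : nonneg b -> 0 < t -> invertible (b + sc t).
Proof.
move=> [hb [s s0 hs]] t0; have st0 : 0 < s + t by lra.
have e : sc (s + t) * sc (s + t)^-1 = 1 by rewrite -scM mulfV ?sc1 // gt_eqF.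
have -> : b + sc t = sc (s + t) * (1 - sc (s + t)^-1 * (sc s - b)).
  by rewrite mulrBr mulr1 mulrA e mul1r scD; nc D.
apply: invertibleM; first by apply: invertible_sc; rewrite gt_eqF.
apply: neumann; rewrite cnorm_scM gtr0_norm ?invr_gt0 // mulrC ltr_pdivrMr // mul1r.
lra.
Qed.

Lemma star_inv x y : star x = x -> x * y = 1 -> y * x = 1 -> star y = y.
Proof.
move=> hx xy yx; apply: (@inv_unique _ _ x).
  by rewrite -{1}hx -starM yx star1.
by [].
Qed.

(** A substitute for the spectral radius formula.  If |b| - b = w^2 were
    invertible and v were the inverse of w, then w^2 >= 1 / |v|^2, that is,
    b <= |b| - 1 / |v|^2, so the norm of b would be smaller than itself. *)
Lemma norm_attained b : nonneg b -> ~ invertible (sc (cnorm b) - b).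
Proof.
move=> hb; have sb := nonneg_star hb; set r := cnorm b.
have [w [hw nw ww wc]] := sqrtP (nonneg_gap sb (lexx r)).
rewrite -ww => /(invertible_comm_mull erefl) [v [wv vw]].
have hv := star_inv hw wv vw.
have v0 : 0 < cnorm v.
  rewrite lt_def cnorm_ge0 andbT; apply/eqP => /cnorm_eq0 v0.
  by move: wv; rewrite v0 mulr0 => /esym/eqP; rewrite oner_eq0.
set k := cnorm v ^+ 2; have k0 : 0 < k by rewrite exprn_gt0.
have [q [hq _ qq qc]] : exists q, [/\ star q = q, nonneg q, q * q = sc k - v * v &
    forall c, c * (sc k - v * v) = (sc k - v * v) * c -> c * q = q * c].
  by apply/sqrtP/nonneg_gap; rewrite ?starM ?hv ?cnorm_sqr.
have wq : w * q = q * w.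
  by apply: qc; rewrite mulrBr mulrBl scC mulrA wv mul1r -mulrA vw mulr1.
(* w commutes with the root q of |v|^2 - v^2, and (w q)^2 = k w^2 - 1 *)
have h : nonneg (sc k * (w * w) - 1).
  have -> : sc k * (w * w) - 1 = (w * q) * (w * q).
    have -> : (w * q) * (w * q) = w * (q * q) * w by rewrite {2}wq; nc D.
    have -> : w * (q * q) * w = sc k * (w * w) - (w * v) * (v * w) by rewrite qq; nc D.
    by rewrite wv vw mulr1.
  by apply: nonneg_sq; rewrite starM hw hq wq.
have h' : nonneg (sc (r - k^-1) - b).
  have -> : sc (r - k^-1) - b = sc k^-1 * (sc k * (w * w) - 1).
    have -> : sc k^-1 * (sc k * (w * w) - 1) = (sc k^-1 * sc k) * (w * w) - sc k^-1 by nc D.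
    by rewrite -scM mulVf ?gt_eqF // sc1 mul1r ww scB; nc D.
  by apply: nonneg_scM; rewrite // invr_ge0 ltW.
have ki : 0 < k^-1 by rewrite invr_gt0.
have r1 : 0 <= r - k^-1.
  apply: nonneg_scI; have := nonnegD h' hb.
  by rewrite subrK.
have := nonneg_norm_le r1 hb h'; rewrite -/r; lra.
Qed.

(** The element b = |c| - c is positive, so |b| - b is not invertible; it
    equals c + (|b| - |c|), which forces |b| <= |c|, and this is positivity
    of c. *)
Lemma nonneg_inv_crit c : star c = c -> (forall t, 0 < t -> invertible (c + sc t)) ->
  nonneg c.
Proof.
move=> hc h; have hb := nonneg_gap hc (lexx _).
set b := _ - c in hb; have := norm_attained hb.
have [le _|lt] := leP (cnorm b) (cnorm c).
  by split=> //; exists (cnorm c).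
case; have -> : sc (cnorm b) - b = c + sc (cnorm b - cnorm c).
  by rewrite {2}/b scB; nc D.
by apply: h; rewrite subr_gt0.
Qed.

(** Half the sum of y and its absolute value a.  It satisfies c^2 = c a, so
    c + t has the inverse (1 - c (a + t)^-1) / t for every t > 0. *)
Lemma nonneg_half_sum y a : star y = y -> nonneg a -> a * a = y * y ->
  y * a = a * y -> nonneg (sc 2^-1 * (y + a)).
Proof.
move=> hy na aa ya; have ha := nonneg_star na.
set c := sc _ * _.
have cc : c * c = c * a.
  have -> : c * a = sc 2^-1 * (sc 2^-1 * ((y + a) * a + (y + a) * a)).
    by rewrite sc_half_double /c; nc D.
  have -> : c * c = sc 2^-1 * (sc 2^-1 * ((y * y + a * y) + (y * a + a * a))).
    by rewrite /c; nc D.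
  by do 2! congr (_ * _); rewrite -aa -ya; nc D.
have ca : c * a = a * c by rewrite /c -mulrA mulrDl mulrDr !mulrDr scCA ya scCA.
apply: nonneg_inv_crit; first by rewrite starM star_sc starD hy ha scC.
move=> t t0; have [e [e1 e2]] := invertible_nonnegD na t0.
have ce : c * e = e * c.
  by apply: (comm_inv e1 e2); rewrite mulrDr mulrDl ca scC.
have tt : sc t * sc t^-1 = 1 by rewrite -scM mulfV ?sc1 // gt_eqF.
have h : (c + sc t) * (1 - c * e) = sc t.
  have -> : (c + sc t) * (1 - c * e) = c + sc t - (c * c + sc t * c) * e by nc D.
  rewrite cc; have -> : c * a + sc t * c = c * (a + sc t) by nc D.
  by rewrite -mulrA e1; nc D.
apply: (@invertibleP _ _ _ ((1 - c * e) * sc t^-1) (sc t^-1 * (1 - c * e))).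
  by rewrite mulrA h.
have h' : (1 - c * e) * (c + sc t) = (c + sc t) * (1 - c * e).
  have -> : (1 - c * e) * (c + sc t) = c + sc t - c * (e * c) - sc t * (c * e) by nc D.
  by rewrite -ce; nc D.
rewrite -mulrA h' h -scC //.
Qed.

(** The absolute value of y is M (1 - w), where w comes from the iteration at
    z = 1 - (y / M)^2.  The explicit form of the positive part is what makes it
    comparable with polynomials in y. *)
Lemma pos_part_core y : star y = y ->
  let M := cnorm y + 1 in let z := 1 - sc (M^-1 ^+ 2) * (y * y) in
  exists w, (forall n, cnorm (root_alg z n - w) <= 1 - root_seq R n) /\
    let c := sc 2^-1 * (y + sc M * (1 - w)) in
    [/\ nonneg c, nonneg (c - y) & c * (c - y) = 0].
Proof.
move=> hy M z; have M0 : 0 < M by rewrite /M ltr_wpDl.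
have zE : z = 1 - (sc M^-1 * y) * (sc M^-1 * y).
  by rewrite /z expr2 scM; nc D.
have hz : star z = z by rewrite starB star1 starM star_sc starM hy scC.
have hz1 : cnorm z <= 1.
  rewrite zE; apply: sq_le1; first by rewrite starM star_sc hy scC.
  rewrite cnorm_scM gtr0_norm ?invr_gt0 // mulrC ler_pdivrMr // mul1r /M; lra.
have [w [hw w1 ww wn wc]] := sqrt_core hz hz1.
exists w; split=> // c; pose a := sc M * (1 - w).
have na : nonneg a.
  apply: nonneg_scM; first exact: ltW.
  split; first by rewrite starB star1 hw.
  by exists 1; rewrite // sc1 opprB addrC subrK.
have aa : a * a = y * y.
  have -> : a * a = sc M * sc M * ((1 - w) * (1 - w)) by rewrite /a; nc D.
  have -> : (1 - w) * (1 - w) = sc (M^-1 ^+ 2) * (y * y) by rewrite ww /z; nc D.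
  rewrite -scM mulrA -scM -expr2 -exprMn mulfV ?gt_eqF // expr1n sc1 mul1r //.
have yz : y * z = z * y by rewrite /z; nc D.
have ya : y * a = a * y.
  by rewrite /a scCA -mulrA; congr (_ * _); rewrite mulrBr mulrBl wc // mulr1 mul1r.
have cy : c - y = sc 2^-1 * (- y + a).
  by rewrite /c -/a -{2}(sc_half_double y); nc D.
split; first exact: nonneg_half_sum.
  rewrite cy; apply: nonneg_half_sum => //; first by rewrite starN hy.
    by rewrite aa mulrNN.
  by rewrite mulNr mulrN ya.
rewrite cy; have -> : c * (sc 2^-1 * (- y + a)) =
  sc 2^-1 * sc 2^-1 * (y * a - a * y + (a * a - y * y)) by rewrite /c -/a; nc D.
by rewrite ya aa !subrr addr0 mulr0.
Qed.

(** Kaplansky's argument.  Write x* x = c - d with c, d positive and c d = 0.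
    For y = x d one gets y* y = - d^3 <= 0, while y y* is positive because
    y y* + y* y is half a sum of two squares.  Invertibility of y y* + t entails that
    of y* y + t, so y* y is positive too; hence d^3 = 0 and d = 0. *)
Lemma nonneg_star_mul x : nonneg (star x * x).
Proof.
pose h := star x * x; have hh : star h = h by rewrite starM starK.
have [w [_ /=]] := pos_part_core hh.
set c := sc _ * _; move=> [nc nd cd]; set d := c - h in nd cd.
have hc := nonneg_star nc; have hd := nonneg_star nd.
have dc : d * c = 0 by rewrite -hc -hd -starM cd star0.
have hE : h = c - d by rewrite /d; nc D.
move: d hE nd cd hd dc => d hE nd cd hd dc.
suff d0 : d = 0 by rewrite -/h hE d0 subr0.
have [k [hk _ kk kc]] := sqrtP nd.
pose y := x * d.
have yy : star y * y = - (d * d * d).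
  rewrite starM hd; have -> : d * star x * y = d * h * d by rewrite /y /h; nc D.
  have -> : d * h * d = d * c * d - d * d * d by rewrite hE; nc D.
  by rewrite dc mul0r sub0r.
have kd : k * d = d * k by rewrite -kk mulrA.
have n3 : nonneg (d * d * d).
  have -> : d * d * d = (k * d) * (k * d).
    have -> : (k * d) * (k * d) = (d * k) * (k * d) by rewrite {1}kd.
    have -> : (d * k) * (k * d) = d * (k * k) * d by nc D.
    by rewrite kk.
  by apply: nonneg_sq; rewrite starM hk hd kd.
have nyy : nonneg (y * star y).
  pose J := iu D.
  have JC : forall u, u * J = J * u := @iuC _ D.
  have JJ : J * J = -1 := iu_sqr D.
  have Js : star J = - J := star_iu D.
  pose p := y + star y; pose q := J * (star y - y).
  have hp : star p = p by rewrite /p starD starK addrC.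
  have hq : star q = q 
    by rewrite /q starM starB starK Js mulrN JC -mulrN opprB.
  have -> : y * star y = sc 2^-1 * (p * p + q * q) + d * d * d.
    have -> : q * q = (J * J) * ((star y - y) * (star y - y)).
      have -> : q * q = J * ((star y - y) * J) * (star y - y) by rewrite /q; nc D.
      by rewrite JC; nc D.
    have -> : p * p + J * J * ((star y - y) * (star y - y)) =
      (y * star y + star y * y) + (y * star y + star y * y) by rewrite JJ /p; nc D.
    by rewrite sc_half_double yy; nc D.
  apply: nonnegD => //; apply: nonneg_scM; first by rewrite invr_ge0.
  by apply: nonnegD; apply: nonneg_sq.
have ny : nonneg (star y * y).
  apply: nonneg_inv_crit; first by rewrite starM starK.
  (* with e inverse to y y* + t, the inverse is (1 - y* e y) / t *)
  move=> t t0; have [e [e1 e2]] := invertible_nonnegD nyy t0.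
  have tt : sc t * sc t^-1 = 1 by rewrite -scM mulfV ?sc1 // gt_eqF.
  have h1 : (star y * y + sc t) * (1 - star y * e * y) = sc t.
    have -> : (star y * y + sc t) * (1 - star y * e * y) =
      star y * y + sc t - star y * ((y * star y + sc t) * e) * y by nc D.
    by rewrite e1; nc D.
  have h2 : (1 - star y * e * y) * (star y * y + sc t) = sc t.
    have -> : (1 - star y * e * y) * (star y * y + sc t) =
      star y * y + sc t - star y * (e * (y * star y + sc t)) * y by nc D.
    by rewrite e2; nc D.
  apply: (@invertibleP _ _ _ ((1 - star y * e * y) * sc t^-1) (sc t^-1 * (1 - star y * e * y))).
    by rewrite mulrA h1.
  by rewrite -mulrA h2 scC.
have d3 : d * d * d = 0.
  apply: cnorm_le0; apply: nonneg_norm_le => //.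
  by rewrite sc0 sub0r -yy.
have : (cnorm d ^+ 2) ^+ 2 = 0.
  by rewrite -!cnorm_sqr ?starM ?hd // mulrA d3 mul0r cnorm0.
by move=> /eqP; rewrite !expf_eq0 /= => /eqP/cnorm_eq0.
Qed.

Lemma positiveP x : positive x <-> nonneg x.
Proof.
split=> [[y ->]|/sqrtP[y [hy _ <- _]]]; first exact: nonneg_star_mul.
by exists y; rewrite hy.
Qed.

End Positivity.

(** * Spectrum and functional calculus of self-adjoint elements *)

Section Spectrum.
Variables (R : realType) (D : cstarType R).
Implicit Types (x y a b c : D) (r s t : R).
Local Notation sc := (@sc R D).

Lemma specP x (z : R[i]) : spectrum x z <-> ~ invertible (x - z%:A).
Proof. by []. Qed.

(** With u = x - Re z and q = Im z, the product of u - iq and u + iq is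
    u^2 + q^2, which is invertible when q is nonzero. *)
Lemma spec_real x (z : R[i]) : star x = x -> spectrum x z -> z = ((complex.Re z)%:C)%C.
Proof.
move=> hx; rewrite specP; case: z => p q /= h.
have [-> //|q0] := eqVneq q 0.
case: h; pose J := iu D; pose u := x - sc p.
have JC : forall v, v * J = J * v := @iuC _ D.
have JJ : J * J = -1 := iu_sqr D.
have -> : x - (p +i* q)%C%:A = u - J * sc q.
  rewrite /u /J /iu /sc -scalerAl mul1r scalerA -addrA -opprD -scalerDl.
  by congr (_ - _ *: _); simpc.
have e : (u - J * sc q) * (u + J * sc q) = u * u + sc (q ^+ 2).
  have -> : (u - J * sc q) * (u + J * sc q) =
    u * u + sc q * (u * J - J * u) - sc q * sc q * (J * J) by nc D.
  by rewrite JC JJ expr2 scM; nc D.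
apply: (@invertible_comm_mull _ _ _ (u + J * sc q)).
  rewrite e; have -> : (u + J * sc q) * (u - J * sc q) =
    u * u + sc q * (J * u - u * J) - sc q * sc q * (J * J) by nc D.
  by rewrite JC JJ expr2 scM; nc D.
rewrite e; apply: invertible_nonnegD; last by rewrite exprn_even_gt0.
by apply: nonneg_sq; rewrite starB star_sc hx.
Qed.

Lemma spec_norm x r : spectrum x (r%:C)%C -> `|r| <= cnorm x.
Proof.
rewrite specP => h; rewrite leNgt; apply/negP => lt; apply: h.
have r0 : 0 < `|r| by apply: le_lt_trans lt.
have rn : r != 0 by rewrite -normr_gt0.
have -> : x - ((r%:C)%C)%:A = sc (- r) * (1 - sc r^-1 * x).
  rewrite mulrBr mulr1 mulrA -scM mulNr mulfV // !scN sc1 mulN1r opprK addrC.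
  by rewrite /sc.
apply: invertibleM; first by apply: invertible_sc; rewrite oppr_eq0.
by apply: neumann; rewrite cnorm_scM normfV mulrC ltr_pdivrMr // mul1r.
Qed.

(** Over the complex numbers Q splits into linear factors, and Q(x) is
    invertible as soon as all the corresponding x - z are. *)
Lemma root_in_spec x (Q : {poly R[i]}) : Q != 0 -> ~ invertible (horner_alg x Q) ->
  exists2 z, spectrum x z & root Q z.
Proof.
move=> Q0 h; apply: contrapT => hn; apply: h.
have [rs Qe] := closed_field_poly_normal Q.
have hr (z : R[i]) : z \in rs -> invertible (x - z%:A).
  move=> zr; apply: contrapT => hz; apply: hn; exists z => //.
  by rewrite Qe rootZ ?lead_coef_eq0 // root_prod_XsubC.
rewrite Qe -mul_polyC rmorphM /= horner_algC.
apply: invertibleM.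
  exists ((lead_coef Q)^-1)%:A; rewrite -!scalerAl -!scalerAr !mul1r !scalerA.
  by rewrite mulVf ?mulfV ?scale1r ?lead_coef_eq0.
elim: rs hr {Qe} => [|z rs IH] hr.
  by rewrite big_nil rmorph1; exists 1; rewrite mulr1.
rewrite big_cons rmorphM; apply: invertibleM; last first.
  by apply: IH => u ur; apply: hr; rewrite inE ur orbT.
by rewrite rmorphB /= horner_algX horner_algC; apply: hr; rewrite inE eqxx.
Qed.

(** The norm of x^2 is a spectral value of x^2, so the polynomial X^2 - |x^2|
    has a root in the spectrum of x. *)
Lemma spec_inhabited x : star x = x -> exists z, spectrum x z.
Proof.
move=> hx; have := norm_attained (nonneg_sq hx); set r := cnorm _ => h.
pose Q : {poly R[i]} := 'X * 'X - ((r%:C)%C)%:P.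
have [| |z hz _] := @root_in_spec x Q; last by exists z.
  apply/negP => /eqP /(congr1 (fun p : {poly R[i]} => p`_2)).
  by rewrite /Q coefB coefC coefXM coefX coef0 /= subr0 => /eqP; rewrite oner_eq0.
move=> hQ; apply: h.
have -> : sc r - x * x = sc (-1) * horner_alg x Q.
  rewrite /Q rmorphB rmorphM /= horner_algX horner_algC scN sc1 mulN1r opprB.
  by [].
by apply: invertibleM => //; apply: invertible_sc; rewrite oppr_eq0 oner_eq0.
Qed.

Lemma star_horner x (q : {poly R[i]}) : star x = x ->
  star (horner_alg x q) = horner_alg x (map_poly conjc q).
Proof.
move=> hx; elim/poly_ind: q => [|p a IH]; first by rewrite !rmorph0 star0.
rewrite !rmorphD !rmorphM /= map_polyX map_polyC /= !horner_algX !horner_algC.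
rewrite starD starM hx IH starZ star1; congr (_ + _).
by rewrite -(comm_horner _ (erefl : x * x = x * x)).
Qed.

(** Apply [norm_attained] to q(x)* q(x) = P(x), where P is the product of q
    with its conjugate: P - |P(x)| has a root z in the spectrum of x, and z is
    real, so that P(z) is the square of the modulus of q(z). *)
Lemma spec_poly_norm x (q : {poly R[i]}) : star x = x ->
  exists2 z, spectrum x z & cnorm (horner_alg x q) = complex.Re `|q.[z]|.
Proof.
move=> hx; pose P := map_poly conjc q * q; pose b := horner_alg x P.
have bE : b = star (horner_alg x q) * horner_alg x q.
  by rewrite /b /P rmorphM /= star_horner.
have := @norm_attained _ _ b; rewrite {1}bE => /(_ (nonneg_star_mul _)).
set r := cnorm b => h.
pose Q : {poly R[i]} := P - ((r%:C)%C)%:P.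
have [z hz] : exists2 z, spectrum x z & root Q z.
  (* if P is the constant r, any spectral value will do *)
  have [Q0|Q0] := eqVneq Q 0.
    by have [z hz] := spec_inhabited hx; exists z; rewrite // Q0 root0.
  apply: root_in_spec => // hQ; apply: h.
  have -> : sc r - b = sc (-1) * horner_alg x Q.
    by rewrite /Q rmorphB /= horner_algC scN sc1 mulN1r opprB.
  by apply: invertibleM => //; apply: invertible_sc; rewrite oppr_eq0 oner_eq0.
rewrite /root /Q hornerD hornerN hornerC subr_eq0 hornerM => /eqP hP.
exists z => //.
have zE := spec_real hx hz.
have zc : z = conjc z by rewrite zE conjc_real.
move: hP; rewrite {1}zc horner_map /=.
have : cnorm (horner_alg x q) ^+ 2 = r by rewrite -cnorm_star -bE.
case: q.[z] => u v <- /= [e _].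
have h0 : 0 <= cnorm (horner_alg x q) by [].
rewrite -[LHS]ger0_norm // -sqrtr_sqr -e; congr Num.sqrt; ring.
Qed.

Lemma spec_poly_ub x (q : {poly R[i]}) e : star x = x ->
  (forall z, spectrum x z -> complex.Re `|q.[z]| <= e) -> cnorm (horner_alg x q) <= e.
Proof. by move=> hx h; have [z hz ->] := spec_poly_norm q hx; apply: h. Qed.

Lemma re_normD (u v : R[i]) :
  complex.Re `|u + v| <= complex.Re `|u| + complex.Re `|v|.
Proof. exact: (@le_normcD R u v). Qed.

(** Two sequences of polynomials with the same uniform limit on the spectrum
    have close values at x, by [spec_poly_norm]. *)
Lemma is_cfc_unique f x c c' : star x = x ->
  is_cfc (@cnorm R D) f x c -> is_cfc (@cnorm R D) f x c' -> c = c'.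
Proof.
move=> hx [p [hp /cvg0P hc]] [p' [hp' /cvg0P hc']].
apply/eqP; rewrite -subr_eq0; apply/eqP/cnorm_small => e e0.
have e4 : 0 < e / 4 by lra.
have [N1 _ h1] := hp _ e4; have [N2 _ h2] := hp' _ e4.
have [//|N3 h3] := hc _ _ e4; have [//|N4 h4] := hc' _ _ e4.
pose n := maxn (maxn N1 N2) (maxn N3 N4).
have n1 : (N1 <= n)%N by rewrite /n; lia.
have n2 : (N2 <= n)%N by rewrite /n; lia.
have n3 : (N3 <= n)%N by rewrite /n; lia.
have n4 : (N4 <= n)%N by rewrite /n; lia.
have hd : cnorm (horner_alg x (p n - p' n)) <= e / 2.
  apply: spec_poly_ub => // z hz.
  have := h1 n n1 z hz; have := h2 n n2 z hz.
  set g := ((f _)%:C)%C => k2 k1.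
  rewrite hornerD hornerN -(subrK g (p n).[z]) -addrA; apply: le_trans (re_normD _ _) _.
  by rewrite distrC in k2; lra.
move: hd; rewrite rmorphB /= => hd.
have := cnorm_tri c (horner_alg x (p n)) c'.
have := cnorm_tri (horner_alg x (p n)) (horner_alg x (p' n)) c'.
have := h3 n n3; have := h4 n n4; rewrite (cnormC c (horner_alg _ _)); lra.
Qed.

End Spectrum.

Section CutDown.
Variables (R : realType) (D : cstarType R).
Implicit Types (x y a b c : D) (r s t : R).
Local Notation sc := (@sc R D).

Fixpoint root_val (t : R) (n : nat) : R :=
  if n is k.+1 then 2^-1 * (t + root_val t k * root_val t k) else 0.

Lemma root_poly_val t n : (root_poly R n).[(t%:C)%C] = ((root_val t n)%:C)%C.
Proof.
elim: n => [|n IH] /=; first by rewrite horner0.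
by rewrite hornerM hornerC hornerD hornerM hornerX IH -rmorphM -rmorphD -rmorphM.
Qed.

(** The scalar counterpart of [sqrt_core]: 1 - v is the fixed point of the
    iteration at 1 - v^2, approached at the same rate, uniformly in v. *)
Lemma root_val_bound v n : 0 <= v <= 1 ->
  0 <= root_val (1 - v ^+ 2) n <= root_seq R n /\ `|root_val (1 - v ^+ 2) n - (1 - v)| <= 1 - root_seq R n.
Proof.
move=> /andP[v0 v1]; set t := 1 - v ^+ 2; have v2 := sqr_ge0 v.
have t0 : 0 <= t by rewrite subr_ge0 expr_le1.
elim: n => [|n [/andP[p0 ps] IH]] /=.
  by rewrite lexx sub0r normrN ger0_norm ?subr_ge0 //; split=> //; lra.
have s1 := root_seq_le1 R n; split.
  apply/andP; split; first by rewrite mulr_ge0 ?invr_ge0 // addr_ge0 // mulr_ge0.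
  rewrite mulrC ler_pM2r ?invr_gt0 // expr2; apply: lerD; first by rewrite /t; lra.
  exact: ler_pM.
have -> : 2^-1 * (t + root_val t n * root_val t n) - (1 - v) =
  2^-1 * ((root_val t n - (1 - v)) * (root_val t n + (1 - v))) by rewrite /t; field.
rewrite normrM ger0_norm ?invr_ge0 // normrM.
have -> : 1 - (1 + root_seq R n ^+ 2) / 2 = 2^-1 * ((1 - root_seq R n) * (1 + root_seq R n)) by field.
rewrite ler_pM2l ?invr_gt0 //; apply: ler_pM => //.
by rewrite ger0_norm; lra.
Qed.

Lemma horner_alg_comp x (p q : {poly R[i]}) :
  horner_alg x (p \Po q) = horner_alg (horner_alg x q) p.
Proof.
elim/poly_ind: p => [|p a IH]; first by rewrite comp_poly0 !rmorph0.
rewrite comp_polyD comp_polyM comp_polyX comp_polyC !rmorphD !rmorphM /=.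
by rewrite !horner_algX !horner_algC IH.
Qed.

(** These three properties are all that is used of (x - e)_+.  The positive
    part built from the square root iteration has them, and it is the functional
    calculus value: the same polynomials converge in norm at x and uniformly
    on the spectrum. *)
Lemma cut_downP x e : star x = x ->
  let c := cut_down (@cnorm R D) x e in
  [/\ nonneg c, nonneg (c - (x - sc e)) & c * (c - (x - sc e)) = 0].
Proof.
move=> hx; pose y := x - sc e.
have hy : star y = y by rewrite starB star_sc hx.
have [w [hw /=]] := pos_part_core hy.
set M := cnorm y + 1 in hw *; set z := 1 - _ * _ in hw; set c := sc _ * _ => hc.
have M0 : 0 < M by rewrite /M ltr_wpDl.
suff h : is_cfc (@cnorm R D) (fun t => Num.max 0 (t - e)) x c.
  suff -> : cut_down (@cnorm R D) x e = c by [].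
  by apply: (is_cfc_unique hx _ h); apply: (xgetPex 0); exists c.
pose cc r : {poly R[i]} := ((r%:C)%C)%:P.
pose Y := 'X - cc e; pose Z := 1 - cc (M^-1 ^+ 2) * (Y * Y).
pose p n := cc 2^-1 * (Y + cc M * (1 - (root_poly R n \Po Z))).
have ccE r : horner_alg x (cc r) = sc r by rewrite horner_algC.
have YE : horner_alg x Y = y by rewrite rmorphB /= horner_algX ccE.
have ZE : horner_alg x Z = z by rewrite rmorphB rmorph1 !rmorphM /= !YE ccE.
have pE n : horner_alg x (p n) = sc 2^-1 * (y + sc M * (1 - root_alg z n)).
  by rewrite rmorphM rmorphD rmorphM (rmorphB _ 1) rmorph1 /= horner_alg_comp ZE YE !ccE.
exists p; split; last first.
  apply/cvg0P => // e' e0; have [n0 hn] := @root_seq_small R (e' / M) (divr_gt0 e0 M0).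
  exists n0 => i /hn; rewrite ltr_pdivlMr // => hi; rewrite pE.
  have -> : sc 2^-1 * (y + sc M * (1 - root_alg z i)) - c = - (sc (2^-1 * M) * (root_alg z i - w)).
    by rewrite /c scM; nc D.
  rewrite cnormN cnorm_scM gtr0_norm ?mulr_gt0 ?invr_gt0 //.
  have := hw i; have := root_seq_le1 R i; have := cnorm_ge0 (root_alg z i - w); nra.
move=> e' e0; have [n0 hn] := @root_seq_small R (e' / M) (divr_gt0 e0 M0).
exists n0 => // i /hn; rewrite ltr_pdivlMr // => hi u hu.
have uE := spec_real hx hu; set t := complex.Re u in uE *.
have tM : `|t - e| <= M.
  have : spectrum y (((t - e)%:C)%C).
    rewrite specP => h; apply: hu; rewrite uE.
    suff -> : x - ((t%:C)%C)%:A = y - (((t - e)%:C)%C)%:A by [].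
    by rewrite -[_%:A]/(sc t) -[X in _ = _ - X]/(sc (t - e)) /y scB; nc D.
  by move=> /spec_norm; rewrite /M; lra.
pose v := `|t - e| / M.
have v01 : 0 <= v <= 1 by rewrite divr_ge0 ?(ltW M0) //= ler_pdivrMr // mul1r.
have [_ hp] := root_val_bound i v01.
have vE : v ^+ 2 = M^-1 ^+ 2 * ((t - e) * (t - e)).
  by rewrite /v exprMn mulrC -normrX ger0_norm ?sqr_ge0 // expr2.
have -> : (p i).[u] = ((2^-1 * ((t - e) + M * (1 - root_val (1 - v ^+ 2) i)))%:C)%C.
  have YU : Y.[u] = ((t - e)%:C)%C by rewrite uE hornerD hornerN hornerX hornerC -rmorphB.
  have ZU : Z.[u] = ((1 - v ^+ 2)%:C)%C.
    rewrite hornerD hornerN hornerM hornerM !hornerC YU vE.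
    by rewrite [in RHS]rmorphB rmorph1 !rmorphM.
  have WU : (1 - (root_poly R i \Po Z)).[u] = ((1 - root_val (1 - v ^+ 2) i)%:C)%C.
    by rewrite hornerD hornerN horner_comp ZU hornerC root_poly_val [in RHS]rmorphB rmorph1.
  rewrite /p hornerM hornerD (hornerM (cc M)) WU YU !hornerC.
  by rewrite [in RHS]rmorphM (rmorphD _ (t - e)) rmorphM.
rewrite -rmorphB normc_def /= expr0n addr0 sqrtr_sqr.
have -> : Num.max 0 (t - e) = 2^-1 * ((t - e) + M * v).
  have -> : M * v = `|t - e| by rewrite /v mulrC divfK ?gt_eqF.
  case: (ltP 0 (t - e)) => h.
    by rewrite gtr0_norm //; field.
  by rewrite ler0_norm // subrr mulr0.
have -> : 2^-1 * (t - e + M * (1 - root_val (1 - v ^+ 2) i)) - 2^-1 * (t - e + M * v) =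
  - (2^-1 * M * (root_val (1 - v ^+ 2) i - (1 - v))) by field.
rewrite normrN normrM gtr0_norm ?mulr_gt0 ?invr_gt0 //.
have s1 := root_seq_le1 R i.
apply: (@le_lt_trans _ _ (2^-1 * M * (1 - root_seq R i))); last by nra.
by rewrite ler_pM2l // mulr_gt0 ?invr_gt0.
Qed.
End CutDown.

(** * Order and Cuntz comparison inside one C*-algebra *)

Section Order.
Variables (R : realType) (D : cstarType R).
Implicit Types (x y z a b c v : D) (r s t : R).
Local Notation sc := (@sc R D).

Definition cle x y := nonneg (y - x).

Lemma nonneg_mul_star x : nonneg (x * star x).
Proof. by rewrite -{1}(starK x); apply: nonneg_star_mul. Qed.

Lemma nonneg_conj c x : nonneg x -> nonneg (c * x * star c).
Proof.
move=> /sqrtP[y [hy _ <- _]].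
have -> : c * (y * y) * star c = (c * y) * star (c * y) by rewrite starM hy; nc D.
exact: nonneg_mul_star.
Qed.

Lemma cle_refl x : cle x x.
Proof. by rewrite /cle subrr; apply: nonneg0. Qed.

Lemma cle_trans y x z : cle x y -> cle y z -> cle x z.
Proof.
rewrite /cle => h1 h2; have -> : z - x = (z - y) + (y - x) by nc D.
exact: nonnegD.
Qed.

Lemma cleD x y x' y' : cle x y -> cle x' y' -> cle (x + x') (y + y').
Proof.
rewrite /cle => h1 h2; have -> : y + y' - (x + x') = (y - x) + (y' - x') by nc D.
exact: nonnegD.
Qed.

Lemma cle_scM r x y : 0 <= r -> cle x y -> cle (sc r * x) (sc r * y).
Proof. by rewrite /cle -mulrBr => r0 h; apply: nonneg_scM. Qed.

Lemma cle_conj c x y : cle x y -> cle (c * x * star c) (c * y * star c).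
Proof.
rewrite /cle => /(nonneg_conj c); congr nonneg; nc D.
Qed.

Lemma nonneg_le x y : nonneg x -> cle x y -> nonneg y.
Proof. by move=> hx hxy; rewrite -(subrK x y); apply: nonnegD. Qed.

Lemma cle_norm x y : nonneg x -> cle x y -> cnorm x <= cnorm y.
Proof.
move=> hx hxy; apply: nonneg_norm_le => //.
have hy := nonneg_le hx hxy.
exact: (cle_trans hxy (nonneg_gap (nonneg_star hy) (lexx _))).
Qed.

Lemma cle_close x y r : star x = x -> star y = y -> cnorm (x - y) <= r ->
  cle x (y + sc r).
Proof.
move=> hx hy h; rewrite /cle.
have -> : y + sc r - x = sc r - (x - y) by nc D.
by apply: nonneg_gap; rewrite ?starB ?hx ?hy.
Qed.

(** The inverse u of y + t; since y u = 1 - t u, positivity of both y u and u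
    puts y u between 0 and 1. *)
Lemma resolvent y t : nonneg y -> 0 < t -> exists u,
  [/\ (y + sc t) * u = 1, nonneg u, y * u = u * y, nonneg (y * u) & cnorm (y * u) <= 1].
Proof.
move=> hy t0; have [u [u1 u2]] := invertible_nonnegD hy t0.
have hs : star (y + sc t) = y + sc t by rewrite starD (nonneg_star hy) star_sc.
have su := star_inv hs u1 u2.
have nu : nonneg u.
  have -> : u = u * (y + sc t) * star u by rewrite u2 su mul1r.
  apply: nonneg_conj; apply: nonnegD => //.
  by apply: nonneg_sc; apply: ltW.
have yu : y * u = u * y.
  by apply: (comm_inv u1 u2); nc D.
have nyu : nonneg (y * u).
  have [k [hk _ kk kc]] := sqrtP hy.
  have uk := kc _ (esym yu).
  have -> : y * u = k * u * star k by rewrite hk -kk -!mulrA uk.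
  exact: nonneg_conj.
exists u; split=> //.
apply: nonneg_norm_le => //.
have -> : sc 1 - y * u = sc t * u by rewrite sc1 -u1; nc D.
by apply: nonneg_scM => //; apply: ltW.
Qed.

Definition cuntz_le a b := forall e : R, 0 < e ->
  exists d : D, cnorm (d * b * star d - a) < e.

Lemma cuntz_leP a b : cuntz_sub (@cnorm R D) a b <-> cuntz_le a b.
Proof.
split.
  move=> [r /cvg0P h] e e0; have [//|n hn] := h _ _ e0.
  by exists (r n); apply: hn.
move=> h.
have [r hr] : {r : nat -> D & forall n, cnorm (r n * b * star (r n) - a) < n.+1%:R^-1}.
  by apply: (@choice _ _ (fun n (d : D) => cnorm (d * b * star d - a) < n.+1%:R^-1)) => n;
     apply: h; rewrite invr_gt0.
exists r; apply/cvg0P => // e e0.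
exists (Num.truncn e^-1) => i hi; apply: lt_le_trans (hr i) _.
rewrite invf_ple ?posrE ?ltr0n //; apply/ltW/(lt_le_trans (truncnS_gt _)).
by rewrite ler_nat.
Qed.

Lemma cuntz_le_conj c b : cuntz_le (c * b * star c) b.
Proof. by move=> e e0; exists c; rewrite subrr cnorm0. Qed.

Lemma cuntz_le_trans b a c : cuntz_le a b -> cuntz_le b c -> cuntz_le a c.
Proof.
move=> hab hbc e e0; have e2 : 0 < e / 2 by lra.
have [r hr] := hab _ e2; pose k := cnorm r ^+ 2 + 1.
have k0 : 0 < k by rewrite /k ltr_wpDl // sqr_ge0.
have [s hs] := hbc _ (divr_gt0 e2 k0); exists (r * s).
have -> : r * s * c * star (r * s) - a =
  r * (s * c * star s - b) * star r + (r * b * star r - a) by rewrite starM; nc D.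
apply: le_lt_trans (cnormD _ _) _.
have h1 : cnorm (r * (s * c * star s - b) * star r) <= cnorm r ^+ 2 * cnorm (s * c * star s - b).
  apply: le_trans (cnormM _ _) _; rewrite cnorm_starE expr2 [leLHS]mulrC -[leRHS]mulrA.
  by apply: ler_wpM2l => //; apply: cnormM.
move: hs; rewrite ltr_pdivlMr // /k; have := cnorm_ge0 (s * c * star s - b); lra.
Qed.

(** With u = (y + t)^-1, p = sqrt u, k = sqrt x and r = k p, the error
    x - r y r* equals t (k p) (k p)*, whose norm is t times that of p x p; and
    p x p <= p y p <= 1. *)
Lemma cuntz_le_cle x y : nonneg x -> cle x y -> cuntz_le x y.
Proof.
move=> nx xy e e0; have ny := nonneg_le nx xy.
have t0 : 0 < e / 2 by lra.
set t := e / 2 in t0; have [u [u1 nu yu nyu yu1]] := resolvent ny t0.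
have [p [hp np pp pc]] := sqrtP nu; have [k [hk nk kk kc]] := sqrtP nx.
have yp := pc _ yu.
have pyp : p * y * p = y * u by rewrite -yp -mulrA pp.
have tu : 1 - y * u = sc t * u by rewrite -u1; nc D.
exists (k * p); rewrite starM hp hk.
have -> : k * p * y * (p * k) - x = - (sc t * ((k * p) * star (k * p))).
  have -> : k * p * y * (p * k) = k * (p * y * p) * k by nc D.
  rewrite starM hp hk pyp.
  have -> : sc t * (k * p * (p * k)) = k * (sc t * (p * p)) * k by nc D.
  by rewrite pp -tu -kk; nc D.
rewrite cnormN cnorm_scM (gtr0_norm t0) cnorm_mulstar -cnorm_star.
have -> : star (k * p) * (k * p) = p * x * star p by rewrite starM hp hk -kk; nc D.
have h : cnorm (p * x * star p) <= 1.
  apply: le_trans (cle_norm (nonneg_conj _ nx) (cle_conj p xy)) _.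
  by rewrite hp pyp.
have ht : t * cnorm (p * x * star p) <= t * 1 by rewrite ler_pM2l.
by apply: le_lt_trans ht _; rewrite /t; lra.
Qed.

(** With u = (v + t)^-1, the error v - u v^3 u equals t (v u + (v u)^2). *)
Lemma cuntz_le_cube v : nonneg v -> cuntz_le v (v * v * v).
Proof.
move=> nv e e0; have t0 : 0 < e / 3 by lra.
set t := e / 3 in t0; have [u [u1 nu vu nvu vu1]] := resolvent nv t0.
exists u; rewrite (nonneg_star nu).
have tu : 1 - v * u = sc t * u by rewrite -u1; nc D.
have -> : u * (v * v * v) * u - v = - (sc t * (v * u + (v * u) * (v * u))).
  have -> : u * (v * v * v) * u = v * u * v * (v * u) by rewrite {1}vu; nc D.
  have -> : sc t * (v * u + v * u * (v * u)) = (sc t * u) * v + (sc t * u) * v * (v * u).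
    by rewrite {1 2}vu; nc D.
  rewrite -tu; have -> : - ((1 - v * u) * v + (1 - v * u) * v * (v * u)) =
    v * u * v * (v * u) - v + (v * u * v - v * (v * u)) by nc D.
  have -> : v * u * v = v * (v * u) by rewrite [in RHS]vu mulrA.
  by rewrite subrr addr0.
rewrite cnormN cnorm_scM (gtr0_norm t0).
have h2 : cnorm (v * u * (v * u)) <= 1.
  by apply: le_trans (cnormM _ _) _; rewrite mulr_ile1.
have : t * cnorm (v * u + v * u * (v * u)) <= t * 2.
  by rewrite ler_pM2l //; apply: le_trans (cnormD _ _) _; lra.
by rewrite /t; lra.
Qed.

(** Applied to the positive part v of a self-adjoint x, for which
    v^3 = v x v <= v z v; this is Rordam's lemma. *)
Lemma cuntz_le_pos_part v x z : nonneg v -> v * (v - x) = 0 -> cle x z -> cuntz_le v z.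
Proof.
move=> nv vx xz.
have vvv : v * v * v = v * x * v.
  by apply/eqP; rewrite -subr_eq0 -mulrBl -mulrBr vx mul0r.
apply: (cuntz_le_trans (cuntz_le_cube nv)); apply: cuntz_le_trans (cuntz_le_conj v z).
rewrite vvv; have := cle_conj v xz; rewrite (nonneg_star nv); apply: cuntz_le_cle.
by rewrite -vvv; have := nonneg_conj v nv; rewrite (nonneg_star nv).
Qed.

End Order.

(** * Matrices over a C*-algebra *)

Section Adjoint.
Variables (R : realType) (A : cstarType R).

Lemma star_sum I (s : seq I) (P : pred I) (F : I -> A) :
  star (\sum_(i <- s | P i) F i) = \sum_(i <- s | P i) star (F i).
Proof. by apply: (big_morph star (@starD _ A)); apply: star0. Qed.

Lemma cnorm_sum I (s : seq I) (P : pred I) (F : I -> A) :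
  cnorm (\sum_(i <- s | P i) F i) <= \sum_(i <- s | P i) cnorm (F i).
Proof.
elim/big_rec2: _ => [|i y x _ h]; first by rewrite cnorm0.
by apply: le_trans (cnormD _ _) _; rewrite lerD2l.
Qed.

Lemma nonneg_sum I (s : seq I) (P : pred I) (F : I -> A) :
  (forall i, P i -> nonneg (F i)) -> nonneg (\sum_(i <- s | P i) F i).
Proof.
move=> h; elim/big_rec: _ => [|i x /h]; first exact: nonneg0.
exact: nonnegD.
Qed.

Definition adj m n (a : 'M[A]_(m, n)) : 'M[A]_(n, m) := (map_mx star a)^T.

Lemma adjE m n (a : 'M[A]_(m, n)) i j : adj a i j = star (a j i).
Proof. by rewrite !mxE. Qed.
Lemma adjK m n (a : 'M[A]_(m, n)) : adj (adj a) = a.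
Proof. by apply/matrixP => i j; rewrite !adjE starK. Qed.
Lemma adjM m n p (a : 'M[A]_(m, n)) (b : 'M[A]_(n, p)) :
  adj (a *m b) = adj b *m adj a.
Proof.
apply/matrixP => i j; rewrite adjE !mxE star_sum; apply: eq_bigr => k _.
by rewrite !adjE starM.
Qed.
Lemma adj0 m n : adj (0 : 'M[A]_(m, n)) = 0.
Proof. by apply/matrixP => i j; rewrite !mxE star0. Qed.
Lemma adj1 n : adj (1%:M : 'M[A]_n) = 1%:M.
Proof.
apply/matrixP => i j; rewrite !mxE eq_sym; case: (i == j).
  by rewrite star1.
by rewrite star0.
Qed.
Lemma adj_block m1 m2 n1 n2 (a : 'M[A]_(m1, n1)) (b : 'M[A]_(m1, n2)) (c : 'M[A]_(m2, n1)) (d : 'M[A]_(m2, n2)) :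
  adj (block_mx a b c d) = block_mx (adj a) (adj c) (adj b) (adj d).
Proof. by rewrite /adj map_block_mx tr_block_mx. Qed.
Lemma adj_row m n1 n2 (a : 'M[A]_(m, n1)) (b : 'M[A]_(m, n2)) :
  adj (row_mx a b) = col_mx (adj a) (adj b).
Proof. by rewrite /adj map_row_mx tr_row_mx. Qed.
Lemma adj_col m1 m2 n (a : 'M[A]_(m1, n)) (b : 'M[A]_(m2, n)) :
  adj (col_mx a b) = row_mx (adj a) (adj b).
Proof. by rewrite /adj map_col_mx tr_col_mx. Qed.

(** The sum of the norms of the entries defines the same convergence as the
    operator norm on square matrices, and is submultiplicative for rectangular
    matrices of all sizes. *)
Definition mxl1 m n (a : 'M[A]_(m, n)) : R := \sum_i \sum_j cnorm (a i j).

Lemma mxl1_ge0 m n (a : 'M[A]_(m, n)) : 0 <= mxl1 a.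
Proof. by apply: sumr_ge0 => i _; apply: sumr_ge0. Qed.

Lemma mxl1_entry m n (a : 'M[A]_(m, n)) i j : cnorm (a i j) <= mxl1 a.
Proof.
rewrite /mxl1 (bigD1 i) //= (bigD1 j) //= -addrA lerDl.
by rewrite addr_ge0 ?sumr_ge0 // => k _; apply: sumr_ge0.
Qed.

Lemma mxl1D m n (a b : 'M[A]_(m, n)) : mxl1 (a + b) <= mxl1 a + mxl1 b.
Proof.
rewrite /mxl1 -big_split; apply: ler_sum => i _; rewrite -big_split.
by apply: ler_sum => j _; rewrite mxE cnormD.
Qed.

Lemma mxl1_adj m n (a : 'M[A]_(m, n)) : mxl1 (adj a) = mxl1 a.
Proof.
rewrite /mxl1 exchange_big; apply: eq_bigr => i _; apply: eq_bigr => j _.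
by rewrite adjE cnorm_starE.
Qed.

Lemma mxl10 m n : mxl1 (0 : 'M[A]_(m, n)) = 0.
Proof. by rewrite /mxl1 big1 // => i _; rewrite big1 // => j _; rewrite mxE cnorm0. Qed.

Lemma mxl1M m n p (a : 'M[A]_(m, n)) (b : 'M[A]_(n, p)) :
  mxl1 (a *m b) <= mxl1 a * mxl1 b.
Proof.
rewrite /mxl1 mulr_suml; apply: ler_sum => i _.
apply: (@le_trans _ _ (\sum_j \sum_k cnorm (a i k) * cnorm (b k j))).
  apply: ler_sum => j _; rewrite mxE; apply: le_trans (cnorm_sum _ _ _) _.
  by apply: ler_sum => k _; apply: cnormM.
rewrite exchange_big mulr_suml; apply: ler_sum => k _ /=.
rewrite -mulr_sumr ler_wpM2l // [leRHS](bigD1 k) //= lerDl.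
by apply: sumr_ge0 => l _; apply: sumr_ge0.
Qed.

End Adjoint.

Section MatrixCStar.
Variables (R : realType) (A : cstarType R) (k : nat).
Local Notation n := k.+1.
Implicit Types (v w : 'cV[A]_n) (a b : 'M[A]_n).

Definition inner v w : A := \sum_i star (v i ord0) * w i ord0.

Lemma innerE v w : inner v w = (adj v *m w) ord0 ord0.
Proof. by rewrite mxE; apply: eq_bigr => i _; rewrite adjE. Qed.

Lemma inner_adj v a w : inner v (a *m w) = inner (adj a *m v) w.
Proof. by rewrite !innerE adjM adjK mulmxA. Qed.

Lemma inner_star v w : star (inner v w) = inner w v.
Proof. by rewrite /inner star_sum; apply: eq_bigr => i _; rewrite starM starK. Qed.

Lemma inner_nonneg v : nonneg (inner v v).
Proof. by apply: nonneg_sum => i _; apply: nonneg_star_mul. Qed.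

Lemma col_norm_ge0 v : 0 <= col_norm v.
Proof. exact: sqrtr_ge0. Qed.
Hint Resolve col_norm_ge0 : core.

Lemma col_norm_sq v : col_norm v ^+ 2 = cnorm (inner v v).
Proof. by rewrite sqr_sqrtr. Qed.

Lemma col_norm_entry v i : cnorm (v i ord0) <= col_norm v.
Proof.
rewrite -ler_sqr ?nnegrE // col_norm_sq -cnorm_star.
apply: cle_norm; first exact: nonneg_star_mul.
rewrite /cle /inner (bigD1 i) //= addrAC subrr add0r.
by apply: nonneg_sum => j _; apply: nonneg_star_mul.
Qed.

Lemma col_norm_le_sum v : col_norm v <= \sum_i cnorm (v i ord0).
Proof.
have s0 : 0 <= \sum_i cnorm (v i ord0) by apply: sumr_ge0.
rewrite -ler_sqr ?nnegrE // col_norm_sq expr2.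
apply: le_trans (cnorm_sum _ _ _) _; rewrite mulr_suml; apply: ler_sum => i _.
rewrite cnorm_star expr2 ler_wpM2l // (bigD1 i) //= lerDl.
by apply: sumr_ge0.
Qed.

Lemma inner_axpy v w (c : A) :
  inner (w - v *m c%:M) (w - v *m c%:M) =
  inner w w - inner w v * c - star c * inner v w + star c * inner v v * c.
Proof.
have e i : (w - v *m c%:M) i ord0 = w i ord0 - v i ord0 * c.
  by rewrite !mxE big_ord1 !mxE eqxx mulr1n.
rewrite /inner !mulr_suml !mulr_sumr -!sumrB mulr_suml -big_split /=.
apply: eq_bigr => i _; rewrite e starB starM; nc A.
Qed.

(** With t the square of the norm of v and c = <v, w>, positivity of
    <x, x> for x = w - v (c / t) gives c* c / t <= <w, w>. *)
Lemma cauchy_schwarz v w : cnorm (inner v w) <= col_norm v * col_norm w.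
Proof.
have [v0|v0] := eqVneq (col_norm v) 0.
  rewrite v0 mul0r /inner big1 ?cnorm0 // => i _.
  suff -> : v i ord0 = 0 by rewrite star0 mul0r.
  by apply: cnorm_le0; rewrite -v0 col_norm_entry.
have vp : 0 < col_norm v by rewrite lt_def v0 /=.
set t := col_norm v ^+ 2; have t0 : 0 < t by rewrite exprn_gt0.
set c := inner v w.
have h := inner_nonneg (w - v *m (sc A t^-1 * c)%:M).
rewrite inner_axpy -(inner_star v w) -/c starM star_sc in h.
have h2 : nonneg (star c * (sc A t - inner v v) * star (star c)).
  by apply: nonneg_conj; apply: nonneg_gap; rewrite ?inner_star // -col_norm_sq.
rewrite starK in h2.
have tt : sc A t * sc A t^-1 = 1 by rewrite -scM mulfV ?sc1 // gt_eqF.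
have h3 : cle (sc A t^-1 * (star c * c)) (inner w w).
  rewrite /cle; have t2 : 0 <= t^-1 * t^-1 by rewrite mulr_ge0 ?invr_ge0 ?(ltW t0).
  have := nonnegD h (nonneg_scM t2 h2); congr nonneg.
  rewrite scM.
  have -> : sc A t^-1 * sc A t^-1 * (star c * (sc A t - inner v v) * c) =
    (sc A t * sc A t^-1) * sc A t^-1 * (star c * c)
    - sc A t^-1 * sc A t^-1 * (star c * inner v v * c) by nc A.
  by rewrite tt; nc A.
have := cle_norm (nonneg_scM (ltW (_ : 0 < t^-1)) (nonneg_star_mul c)) h3.
rewrite invr_gt0 => /(_ t0).
rewrite cnorm_scM gtr0_norm ?invr_gt0 // cnorm_star -col_norm_sq mulrC ler_pdivrMr // => h4.
by rewrite -ler_sqr ?nnegrE ?mulr_ge0 // exprMn mulrC.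
Qed.

Lemma col_normD v w : col_norm (v + w) <= col_norm v + col_norm w.
Proof.
rewrite -ler_sqr ?nnegrE ?addr_ge0 // col_norm_sq.
have -> : inner (v + w) (v + w) = inner v v + inner v w + (inner w v + inner w w).
  rewrite /inner -!big_split /=; apply: eq_bigr => i _.
  rewrite !mxE starD; move: (v i ord0) (w i ord0) => p q; nc A.
have h1 := cauchy_schwarz v w; have h2 := cauchy_schwarz w v.
have h3 := col_norm_sq v; have h4 := col_norm_sq w.
have := cnormD (inner v v + inner v w) (inner w v + inner w w).
have := cnormD (inner v v) (inner v w); have := cnormD (inner w v) (inner w w).
rewrite -h3 -h4 sqrrD mulr2n (mulrC (col_norm w)) in h2 *; lra.
Qed.

Lemma col_norm_scale v r : col_norm (v *m (sc A r)%:M) = `|r| * col_norm v.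
Proof.
apply/eqP; rewrite -(@eqrXn2 _ 2) ?mulr_ge0 //; apply/eqP.
rewrite exprMn !col_norm_sq.
have -> : inner (v *m (sc A r)%:M) (v *m (sc A r)%:M) = sc A (r * r) * inner v v.
  rewrite /inner mulr_sumr; apply: eq_bigr => i _.
  by rewrite !mxE big_ord1 !mxE eqxx mulr1n starM star_sc scM; move: (v i ord0) => p; nc A.
by rewrite cnorm_scM normrM expr2.
Qed.

Lemma col_norm_mulmx a v : col_norm (a *m v) <= mxl1 a * col_norm v.
Proof.
apply: le_trans (col_norm_le_sum _) _; rewrite /mxl1 mulr_suml.
apply: ler_sum => i _; rewrite mxE mulr_suml; apply: le_trans (cnorm_sum _ _ _) _.
apply: ler_sum => j _; apply: le_trans (cnormM _ _) _.
by apply: ler_wpM2l => //; apply: col_norm_entry.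
Qed.

Lemma mat_norm_has_sup a :
  has_sup [set col_norm (a *m v) | v in [set v : 'cV[A]_n | col_norm v <= 1]].
Proof.
have h0 : col_norm (0 : 'cV[A]_n) <= 1.
  rewrite /col_norm big1 ?cnorm0 ?sqrtr0 // => i _.
  by rewrite mxE mulr0.
split; first by exists (col_norm (a *m 0)); exists 0.
exists (mxl1 a) => _ [v /= v1 <-]; apply: le_trans (col_norm_mulmx _ _) _.
by rewrite ler_piMr // mxl1_ge0.
Qed.

Lemma mat_norm_unit a v : col_norm v <= 1 -> col_norm (a *m v) <= mat_norm a.
Proof. by move=> v1; apply: (ub_le_sup (mat_norm_has_sup a).2); exists v. Qed.

Lemma mat_norm_ge0 a : 0 <= mat_norm a.
Proof.
apply: le_trans (mat_norm_unit (v := 0) _ _) => //.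
by rewrite /col_norm big1 ?cnorm0 ?sqrtr0 // => i _; rewrite mxE mulr0.
Qed.

(** By scaling; a column of norm zero is killed because [col_norm_mulmx] is
    already a bound. *)
Lemma mat_norm_mulv a v : col_norm (a *m v) <= mat_norm a * col_norm v.
Proof.
have [v0|v0] := eqVneq (col_norm v) 0.
  rewrite v0 mulr0; apply: le_trans (col_norm_mulmx _ _) _.
  by rewrite v0 mulr0.
have vp : 0 < col_norm v by rewrite lt_def v0 /=.
rewrite -ler_pdivrMr // mulrC -{1}[(col_norm v)^-1]gtr0_norm ?invr_gt0 //.
rewrite -col_norm_scale -mulmxA; apply: mat_norm_unit.
by rewrite col_norm_scale gtr0_norm ?invr_gt0 // mulVf.
Qed.

Lemma mat_norm_le a r : (forall v, col_norm v <= 1 -> col_norm (a *m v) <= r) ->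
  mat_norm a <= r.
Proof.
move=> h; apply: ge_sup; first exact: (mat_norm_has_sup a).1.
by move=> _ [v v1 <-]; apply: h.
Qed.

Lemma mat_norm_entry a i j : cnorm (a i j) <= mat_norm a.
Proof.
have d1 : col_norm (delta_mx j ord0 : 'cV[A]_n) <= 1.
  rewrite /col_norm (bigD1 j) //= big1 => [|l lj].
    by rewrite !mxE !eqxx star1 mulr1 addr0 cnorm1 sqrtr1.
  by rewrite !mxE (negPf lj) mulr0.
apply: le_trans (mat_norm_unit a d1); apply: le_trans (col_norm_entry _ i).
rewrite mxE (bigD1 j) //= big1 ?addr0 => [|l lj]; rewrite !mxE ?eqxx ?mulr1 //.
by rewrite (negPf lj) mulr0.
Qed.

Lemma mat_norm_mxl1 a : mat_norm a <= mxl1 a.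
Proof.
apply: mat_norm_le => v v1; apply: le_trans (col_norm_mulmx _ _) _.
by rewrite ler_piMr // mxl1_ge0.
Qed.

Local Notation M := (matalg A k).

Lemma mat_starE (a : M) : star a = adj a.
Proof. by apply/matrixP => i j; rewrite adjE mxE. Qed.

Fact mat_norm_eq0 (a : M) : mat_norm a = 0 -> a = 0.
Proof.
move=> h; apply/matrixP => i j; rewrite [RHS]mxE; apply: cnorm_le0.
by rewrite -h mat_norm_entry.
Qed.

Fact mat_normD (a b : M) : mat_norm (a + b) <= mat_norm a + mat_norm b.
Proof.
apply: mat_norm_le => v v1; rewrite mulmxDl; apply: le_trans (col_normD _ _) _.
by apply: lerD; apply: mat_norm_unit.
Qed.

Fact mat_normM (a b : M) : mat_norm (a * b) <= mat_norm a * mat_norm b.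
Proof.
apply: mat_norm_le => v v1; rewrite -mulmxA; apply: le_trans (mat_norm_mulv _ _) _.
by apply: ler_wpM2l; [exact: mat_norm_ge0|exact: mat_norm_unit].
Qed.

Lemma mat_normZ_le (c : R[i]) (a : M) :
  mat_norm (c *: a) <= complex.Re `|c| * mat_norm a.
Proof.
apply: mat_norm_le => v v1.
have e : col_norm ((c *: a : M) *m v) = complex.Re `|c| * col_norm ((a : 'M[A]_n) *m v).
  have c0 : 0 <= complex.Re `|c| by rewrite normc_def /= sqrtr_ge0.
  apply/eqP; rewrite -(@eqrXn2 _ 2) ?mulr_ge0 //; apply/eqP.
  rewrite exprMn !col_norm_sq.
  have ei i : ((c *: a : M) *m v) i ord0 = c *: ((a : 'M[A]_n) *m v) i ord0.
    by rewrite !mxE scaler_sumr; apply: eq_bigr => j _; rewrite !mxE scalerAl.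
  have -> : inner ((c *: a : M) *m v) ((c *: a : M) *m v) =
    (conjc c * c) *: inner ((a : 'M[A]_n) *m v) ((a : 'M[A]_n) *m v).
    rewrite /inner scaler_sumr; apply: eq_bigr => i _.
    by rewrite !ei starZ -scalerAl -scalerAr scalerA.
  rewrite cnormZ; congr (_ * _); rewrite normrM.
  by case: c {c0 ei} => p q; rewrite !normc_def /= sqrrN; simpc; rewrite /= expr2.
rewrite e; apply: ler_wpM2l; first by rewrite normc_def /= sqrtr_ge0.
exact: mat_norm_unit.
Qed.

Fact mat_normZ (c : R[i]) (a : M) : mat_norm (c *: a) = complex.Re `|c| * mat_norm a.
Proof.
have [->|c0] := eqVneq c 0.
  rewrite scale0r normr0 mul0r; apply/eqP; rewrite eq_le mat_norm_ge0 andbT.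
  by apply: le_trans (mat_norm_mxl1 _) _; rewrite mxl10.
apply/eqP; rewrite eq_le mat_normZ_le /=.
have nc : (complex.Re `|c|) * complex.Re `|c^-1| = 1.
  have : `|c| * `|c^-1| = 1 by rewrite -normrM mulfV ?normr1.
  by rewrite !normc_def; simpc => -[].
have n0 : 0 <= complex.Re `|c| by rewrite normc_def /= sqrtr_ge0.
have := mat_normZ_le c^-1 (c *: a); rewrite scalerA mulVf // scale1r => h.
apply: le_trans (ler_wpM2l n0 h) _.
by rewrite mulrA nc mul1r.
Qed.

(** The square of the norm of b v is the norm of <v, b* b v>, which the
    Cauchy-Schwarz inequality bounds by that of b* b. *)
Fact mat_norm_star (a : M) : mat_norm (star a * a) = mat_norm a ^+ 2.
Proof.
have h (b : M) : mat_norm b ^+ 2 <= mat_norm (star b * b).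
  have s0 := mat_norm_ge0 (star b * b : M).
  rewrite -(sqr_sqrtr s0) ler_sqr ?nnegrE ?sqrtr_ge0 ?mat_norm_ge0 //.
  apply: mat_norm_le => v v1; rewrite -ler_sqr ?nnegrE ?sqrtr_ge0 //.
  rewrite (sqr_sqrtr s0) col_norm_sq inner_adj -inner_star cnorm_starE mulmxA.
  rewrite -mat_starE; apply: le_trans (cauchy_schwarz _ _) _.
  have h1 := mat_norm_unit (star b * b : M) v1.
  apply: (@le_trans _ _ (1 * mat_norm (star b * b : M))); last by rewrite mul1r.
  exact: ler_pM.
have h2 (b : M) : mat_norm b <= mat_norm (star b).
  have := mat_norm_ge0 b; rewrite le_eqVlt => /orP[/eqP <-|b0]; first exact: mat_norm_ge0.
  rewrite -(ler_pM2r b0) -expr2; apply: le_trans (h b) _; exact: mat_normM.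
have h3 : mat_norm (star a) = mat_norm a.
  by apply/eqP; rewrite eq_le h2 andbT -{2}(starK a) h2.
apply/eqP; rewrite eq_le h andbT; apply: le_trans (mat_normM _ _) _.
by rewrite h3 expr2.
Qed.

Fact mat_norm_complete (u : nat -> M) :
  (forall e : R, 0 < e -> exists n0 : nat, forall i j : nat,
     (n0 <= i)%N -> (n0 <= j)%N -> mat_norm (u i - u j) < e) ->
  exists l : M, (fun i => mat_norm (u i - l)) @ \oo --> (0 : R).
Proof.
move=> h.
have hl p q : exists l : A, climit (fun i => u i p q) l.
  apply: cauchy_climit => e /h [n0 hn]; exists n0 => i j ni ij.
  have := hn j i (leq_trans ni ij) ni; apply: le_lt_trans.
  by have := mat_norm_entry (u j - u i) p q; rewrite !mxE.
have [l hlim] := choice (fun pq : 'I_n * 'I_n => hl pq.1 pq.2).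
exists (\matrix_(p, q) l (p, q)); apply/cvg0P => [i|e e0]; first exact: mat_norm_ge0.
have n2 : 0 < (n * n)%:R + 1 :> R by rewrite ltr_wpDl.
have e2 : 0 < e / ((n * n)%:R + 1) by rewrite divr_gt0.
have [N hN] := choice (fun pq : 'I_n * 'I_n => hlim pq _ e2).
exists (\max_pq N pq)%N => i hi; apply: le_lt_trans (mat_norm_mxl1 _) _.
apply: (@le_lt_trans _ _ (\sum_(p < n) \sum_(q < n) (e / ((n * n)%:R + 1)))).
  apply: ler_sum => p _; apply: ler_sum => q _; rewrite !mxE.
  by apply/ltW/(hN (p, q)); apply: leq_trans hi; apply: (leq_bigmax (p, q)).
rewrite !sumr_const !card_ord -mulrnA -[(_ / _) *+ _]mulr_natr mulrAC ltr_pdivrMr //.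
by rewrite ltr_pM2l // ltrDl.
Qed.

HB.instance Definition _ := StarAlgebra_isCStar.Build R M
  mat_norm_eq0 mat_normD mat_normZ mat_normM mat_norm_star mat_norm_complete.

End MatrixCStar.

(** * Cuntz comparison of matrices of different sizes *)

Section MatrixCuntz.
Variables (R : realType) (A : cstarType R).

(** Rectangular r allow a and b to have different sizes without padding; on
    square matrices of equal size this is Cuntz subequivalence, by
    [mx_cuntz_le]. *)
Definition mx_cuntz n m (a : 'M[A]_n) (b : 'M[A]_m) : Prop :=
  forall e : R, 0 < e -> exists r : 'M[A]_(n, m), mxl1 (r *m b *m adj r - a) < e.

Lemma mx_cuntz_conj n m (r : 'M[A]_(n, m)) b : mx_cuntz (r *m b *m adj r) b.
Proof. by move=> e e0; exists r; rewrite subrr mxl10. Qed.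

Lemma mx_cuntz_refl n (a : 'M[A]_n) : mx_cuntz a a.
Proof. by have := mx_cuntz_conj 1%:M a; rewrite mul1mx adj1 mulmx1. Qed.

Lemma mx_cuntz0 n m (b : 'M[A]_m) : mx_cuntz (0 : 'M[A]_n) b.
Proof. by have := mx_cuntz_conj (0 : 'M[A]_(n, m)) b; rewrite !mul0mx. Qed.

Lemma mx_cuntz_trans n m p (b : 'M[A]_m) (a : 'M[A]_n) (c : 'M[A]_p) :
  mx_cuntz a b -> mx_cuntz b c -> mx_cuntz a c.
Proof.
move=> hab hbc e e0; have e2 : 0 < e / 2 by lra.
have [r hr] := hab _ e2; pose k := mxl1 r ^+ 2 + 1.
have k0 : 0 < k by rewrite /k ltr_wpDl // sqr_ge0.
have [s hs] := hbc _ (divr_gt0 e2 k0); exists (r *m s).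
have -> : r *m s *m c *m adj (r *m s) - a =
  r *m (s *m c *m adj s - b) *m adj r + (r *m b *m adj r - a).
  by rewrite adjM mulmxBr mulmxBl !mulmxA addrA subrK.
apply: le_lt_trans (mxl1D _ _) _.
set d := s *m c *m adj s - b in hs *.
have h1 : mxl1 (r *m d *m adj r) <= mxl1 r ^+ 2 * mxl1 d.
  apply: le_trans (mxl1M _ _) _; rewrite mxl1_adj expr2 [leLHS]mulrC -[leRHS]mulrA.
  by apply: ler_wpM2l; [exact: mxl1_ge0|exact: mxl1M].
move: hs; rewrite ltr_pdivlMr // /k; have := mxl1_ge0 d; lra.
Qed.

Lemma mxl1_le_mat_norm k (a : 'M[A]_k.+1) : mxl1 a <= (k.+1 * k.+1)%:R * mat_norm a.
Proof.
apply: (@le_trans _ _ (\sum_(i < k.+1) \sum_(j < k.+1) mat_norm a)).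
  by apply: ler_sum => i _; apply: ler_sum => j _; apply: mat_norm_entry.
by rewrite !sumr_const !card_ord -mulrnA mulr_natl.
Qed.

Lemma mx_cuntz_le k (a b : matalg A k) : cuntz_le a b <-> mx_cuntz a b.
Proof.
split=> h e e0.
  have k0 : 0 < (k.+1 * k.+1)%:R :> R by rewrite ltr0n.
  have [r hr] := h _ (divr_gt0 e0 k0); exists r; rewrite -mat_starE.
  apply: le_lt_trans (mxl1_le_mat_norm _) _.
  by move: hr; rewrite ltr_pdivlMr // mulrC.
have [r hr] := h _ e0; exists r; rewrite mat_starE.
exact: le_lt_trans (mat_norm_mxl1 _) hr.
Qed.

(** Padding with zeros is conjugation by these matrices. *)
Definition partial_id p q : 'M[A]_(p, q) := \matrix_(i, j) ((i : nat) == j)%:R.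

Lemma adj_partial_id p q : adj (partial_id p q) = partial_id q p.
Proof.
apply/matrixP => i j; rewrite adjE !mxE eq_sym; case: (_ == _).
  by rewrite star1.
by rewrite star0.
Qed.

Lemma partial_id_mul p q n (b : 'M[A]_(q, n)) i j :
  (partial_id p q *m b) i j = if insub (i : nat) is Some i' then b i' j else 0.
Proof.
rewrite mxE; case: insubP => [i' _ ii'|hi].
  rewrite (bigD1 i') //= big1 ?addr0 => [|l li]; rewrite mxE.
    by rewrite -ii' eqxx mul1r.
  by rewrite -ii' eq_sym [_ == _](negPf li) mul0r.
rewrite big1 // => l _; rewrite mxE; case: eqP => [il|]; last by rewrite mul0r.
by rewrite il ltn_ord in hi.
Qed.

Lemma mul_partial_id p q n (b : 'M[A]_(n, q)) i j :
  (b *m partial_id q p) i j = if insub (j : nat) is Some j' then b i j' else 0.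
Proof.
rewrite -[b *m _]adjK adjM adj_partial_id adjE partial_id_mul.
by case: insub => [j'|]; rewrite ?adjE ?starK ?star0.
Qed.

Lemma padE k l (a : matalg A k) : pad l a = partial_id l.+1 k.+1 *m a *m partial_id k.+1 l.+1.
Proof.
apply/matrixP => i j; rewrite mul_partial_id !mxE.
case: (insub (j : nat)) => [j'|]; last by case: insub.
by rewrite partial_id_mul; case: insub.
Qed.

Lemma partial_idK p q : (p <= q)%N -> partial_id p q *m partial_id q p = 1%:M.
Proof.
move=> pq; apply/matrixP => i j; rewrite partial_id_mul !mxE.
by rewrite (insubT (fun x => x < q)%N (leq_trans (ltn_ord i) pq)) mxE.
Qed.

Lemma padK k l (a : matalg A k) : (k <= l)%N ->
  a = partial_id k.+1 l.+1 *m pad l a *m partial_id l.+1 k.+1.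
Proof.
by move=> kl; rewrite padE !mulmxA partial_idK // mul1mx -mulmxA partial_idK // mulmx1.
Qed.

Lemma mx_cuntz_pad k l (a : matalg A k) : mx_cuntz (pad l a : 'M[A]_l.+1) (a : 'M[A]_k.+1).
Proof. by rewrite padE -(adj_partial_id l.+1 k.+1); apply: mx_cuntz_conj. Qed.

Lemma mx_cuntz_unpad k l (a : matalg A k) : (k <= l)%N ->
  mx_cuntz (a : 'M[A]_k.+1) (pad l a : 'M[A]_l.+1).
Proof. by move=> kl; rewrite {1}(padK a kl) -(adj_partial_id k.+1 l.+1); apply: mx_cuntz_conj. Qed.

Definition minf_mx (x : minf A) : 'M[A]_((projT1 x).+1) := projT2 x.

Definition minf_cuntz (x y : minf A) : Prop := mx_cuntz (minf_mx x) (minf_mx y).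

Lemma minf_cuntzP (x y : minf A) : minf_cuntz_sub x y <-> minf_cuntz x y.
Proof.
rewrite /minf_cuntz_sub /minf_cuntz; set l := maxn _ _.
have hx : (projT1 x <= l)%N by apply: leq_maxl.
have hy : (projT1 y <= l)%N by apply: leq_maxr.
rewrite -/(@cnorm R (matalg A l)) cuntz_leP mx_cuntz_le; split=> h.
  apply: mx_cuntz_trans (mx_cuntz_unpad _ hx) _; apply: mx_cuntz_trans h _; exact: mx_cuntz_pad.
apply: mx_cuntz_trans (mx_cuntz_pad _ _) _; apply: mx_cuntz_trans h _; exact: mx_cuntz_unpad.
Qed.

Definition dsum n m (a : 'M[A]_n) (b : 'M[A]_m) : 'M[A]_(n + m) := block_mx a 0 0 b.

Lemma mxl1_dsum n m (a : 'M[A]_n) (b : 'M[A]_m) : mxl1 (dsum a b) = mxl1 a + mxl1 b.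
Proof.
rewrite /mxl1 /dsum big_split_ord /=; congr (_ + _); apply: eq_bigr => i _;
  rewrite big_split_ord /=.
  rewrite [X in _ + X]big1 ?addr0 => [|j _]; last by rewrite block_mxEur mxE cnorm0.
  by apply: eq_bigr => j _; rewrite block_mxEul.
rewrite [X in X + _]big1 ?add0r => [|j _]; last by rewrite block_mxEdl mxE cnorm0.
by apply: eq_bigr => j _; rewrite block_mxEdr.
Qed.

Lemma mx_cuntz_dsum n m p q (a : 'M[A]_n) (b : 'M[A]_m) (c : 'M[A]_p) (d : 'M[A]_q) :
  mx_cuntz a c -> mx_cuntz b d -> mx_cuntz (dsum a b) (dsum c d).
Proof.
move=> hac hbd e e0; have e2 : 0 < e / 2 by lra.
have [r hr] := hac _ e2; have [s hs] := hbd _ e2.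
exists (block_mx r 0 0 s).
have -> : block_mx r 0 0 s *m dsum c d *m adj (block_mx r 0 0 s) - dsum a b =
  dsum (r *m c *m adj r - a) (s *m d *m adj s - b).
  rewrite adj_block !adj0 /dsum !mulmx_block opp_block_mx add_block_mx.
  by rewrite !(mul0mx, mulmx0, addr0, add0r, oppr0).
by rewrite mxl1_dsum; lra.
Qed.

(** The matrix r is the permutation that exchanges the two middle blocks. *)
Lemma mx_cuntz_dsumACA n m p q (a : 'M[A]_n) (b : 'M[A]_m) (c : 'M[A]_p) (d : 'M[A]_q) :
  mx_cuntz (dsum (dsum a b) (dsum c d)) (dsum (dsum a c) (dsum b d)).
Proof.
pose r : 'M[A]_((n + m) + (p + q), (n + p) + (m + q)) :=
  block_mx (block_mx 1%:M 0 0 0) (block_mx 0 0 1%:M 0)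
           (block_mx 0 1%:M 0 0) (block_mx 0 0 0 1%:M).
have := mx_cuntz_conj r (dsum (dsum a c) (dsum b d)); congr mx_cuntz.
rewrite /r /dsum !adj_block !adj0 !adj1 !mulmx_block.
by rewrite !(mul0mx, mulmx0, mul1mx, mulmx1, addr0, add0r, mulmx_block, add_block_mx, block_mx0).
Qed.

Lemma mx_cuntz_inl n m (a : 'M[A]_n) (b : 'M[A]_m) : mx_cuntz a (dsum a b).
Proof.
have := mx_cuntz_conj (row_mx 1%:M 0) (dsum a b); congr mx_cuntz.
rewrite adj_row adj1 adj0 /dsum mul_row_block mul_row_col.
by rewrite !(mul0mx, mulmx0, mul1mx, mulmx1, addr0).
Qed.

Lemma mx_cuntz_dsum0 n m (a : 'M[A]_n) : mx_cuntz (dsum a (0 : 'M[A]_m)) a.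
Proof.
have := mx_cuntz_conj (col_mx 1%:M (0 : 'M[A]_(m, n))) a; congr mx_cuntz.
rewrite adj_col adj1 adj0 /dsum mul_col_mx mul_col_row.
by rewrite !(mul0mx, mulmx0, mul1mx, mulmx1).
Qed.

Lemma minf_cuntz_trans y x z : minf_cuntz x y -> minf_cuntz y z -> minf_cuntz x z.
Proof. exact: mx_cuntz_trans. Qed.

Lemma minf_cuntz_dsum x y x' y' : minf_cuntz x x' -> minf_cuntz y y' -> minf_cuntz (minf_dsum x y) (minf_dsum x' y').
Proof.
exact: (@mx_cuntz_dsum _ _ _ _ (minf_mx x) (minf_mx y) (minf_mx x') (minf_mx y')).
Qed.

Lemma minf_cuntz_dsumACA x y z t :
  minf_cuntz (minf_dsum (minf_dsum x y) (minf_dsum z t)) (minf_dsum (minf_dsum x z) (minf_dsum y t)).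
Proof.
exact: (mx_cuntz_dsumACA (minf_mx x) (minf_mx y) (minf_mx z) (minf_mx t)).
Qed.

Lemma minf_sumS n (x : 'I_n.+1 -> minf A) :
  minf_sum x = minf_dsum (x ord0) (minf_sum (fun j => x (lift ord0 j))).
Proof. exact: big_ord_recl. Qed.

Lemma minf_cuntz_mul_dsum m x y :
  minf_cuntz (minf_mul m (minf_dsum x y)) (minf_dsum (minf_mul m x) (minf_mul m y)).
Proof.
elim: m => [|m IH]; first by rewrite /minf_mul /minf_sum !big_ord0; apply: mx_cuntz0.
rewrite /minf_mul !minf_sumS; apply: minf_cuntz_trans (minf_cuntz_dsumACA _ _ _ _).
by apply: minf_cuntz_dsum => //; apply: mx_cuntz_refl.
Qed.

Lemma minf_positive_dsum (x y : minf A) : minf_positive x -> minf_positive y ->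
  minf_positive (minf_dsum x y).
Proof.
case: x y => [k a] [l b] [/= c ->] [/= d ->].
exists (dsum (c : 'M[A]_k.+1) (d : 'M[A]_l.+1)); rewrite /= !mat_starE.
rewrite -[RHS]/(adj (dsum (c : 'M[A]_k.+1) (d : 'M[A]_l.+1)) *m dsum c d).
rewrite /dsum adj_block !adj0 mulmx_block.
by rewrite !(mul0mx, mulmx0, addr0, add0r).
Qed.

Lemma minf_sum_eq0 n (x : 'I_n -> minf A) : (forall j, minf_mx (x j) = 0) ->
  minf_mx (minf_sum x) = 0.
Proof.
elim: n x => [|n IH] x h; first by rewrite /minf_sum big_ord0.
rewrite minf_sumS.
rewrite -[LHS]/(dsum (minf_mx (x ord0)) (minf_mx (minf_sum (fun j => x (lift ord0 j))))).
by rewrite h IH // /dsum block_mx0.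
Qed.

Lemma mx_cuntz0_eq0 n m (a : 'M[A]_n) : mx_cuntz a (0 : 'M[A]_m) -> a = 0.
Proof.
move=> h; apply/matrixP => i j; rewrite mxE; apply: cnorm_small => e /h [r].
rewrite mulmx0 mul0mx => hr.
by have := mxl1_entry (0 - a) i j; rewrite !mxE sub0r cnormN; lra.
Qed.

End MatrixCuntz.

(** * Amplification of an inclusion to matrices *)

Section Inclusion.
Variables (R : realType) (D B : cstarType R) (iota : {linear B -> D}).
Hypothesis iotaP : cstar_inclusion (@cnorm R D) iota.

Lemma inclM x y : iota (x * y) = iota x * iota y.
Proof. by case: iotaP => + _ _; apply. Qed.
Lemma incl_star x : iota (star x) = star (iota x).
Proof. by case: iotaP => _ + _; apply. Qed.
Lemma incl_norm x : cnorm (iota x) = cnorm x.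
Proof. by case: iotaP => _ _; apply. Qed.

Lemma incl_nonneg x : nonneg x -> nonneg (iota x).
Proof.
move=> /positiveP[y ->]; apply/positiveP; exists (iota y).
by rewrite inclM incl_star.
Qed.

Lemma incl_cle x y : cle x y -> cle (iota x) (iota y).
Proof. by rewrite /cle -linearB; apply: incl_nonneg. Qed.

Lemma incl_sc r x : iota (sc B r * x) = sc D r * iota x.
Proof. by rewrite !mul_scl linearZ. Qed.

End Inclusion.

Section Amplification.
Variables (R : realType) (A B : cstarType R) (k : nat).
Variable iota : {linear B -> matalg A k}.
Hypothesis iotaP : cstar_inclusion (@cnorm R (matalg A k)) iota.
Local Notation K := k.+1.

Definition unvec m (u : 'I_(m * K)) : 'I_m * 'I_K :=
  enum_val (cast_ord (esym (mxvec_cast m K)) u).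

Lemma unvecK m (i : 'I_m) (a : 'I_K) : unvec (mxvec_index i a) = (i, a).
Proof. by rewrite /unvec /mxvec_index cast_ordK enum_rankK. Qed.

Lemma sum_vec m (V : nmodType) (F : 'I_(m * K) -> V) :
  \sum_u F u = \sum_i \sum_a F (mxvec_index i a).
Proof.
rewrite pair_bigA /= (reindex _ (curry_mxvec_bij m K)) /=.
by apply: eq_bigr => -[i a] _.
Qed.

(** The map M_p(B) -> M_p(M_K(A)) = M_(pK)(A) induced by iota, on rectangular
    matrices as well.  A row or column of the result is a pair of indices,
    encoded by [mxvec_index]. *)
Definition ampl p q (x : 'M[B]_(p, q)) : 'M[A]_(p * K, q * K) :=
  \matrix_(u, v) (iota (x (unvec u).1 (unvec v).1) : 'M[A]_K) (unvec u).2 (unvec v).2.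

Lemma amplE p q (x : 'M[B]_(p, q)) i a j b :
  ampl x (mxvec_index i a) (mxvec_index j b) = (iota (x i j) : 'M[A]_K) a b.
Proof. by rewrite mxE !unvecK. Qed.

Lemma amplP p q (X Y : 'M[A]_(p * K, q * K)) :
  (forall i a j b, X (mxvec_index i a) (mxvec_index j b) =
                   Y (mxvec_index i a) (mxvec_index j b)) -> X = Y.
Proof.
move=> h; apply/matrixP => u v.
by case/mxvec_indexP: u => i a; case/mxvec_indexP: v => j b.
Qed.

Lemma amplD p q (x y : 'M[B]_(p, q)) : ampl (x + y) = ampl x + ampl y.
Proof. by apply: amplP => i a j b; rewrite [in RHS]mxE !amplE mxE linearD mxE. Qed.

Lemma amplB p q (x y : 'M[B]_(p, q)) : ampl (x - y) = ampl x - ampl y.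
Proof. by apply: amplP => i a j b; rewrite [in RHS]mxE [X in _ = _ + X]mxE !amplE !mxE linearB !mxE. Qed.

Lemma ampl0 p q : ampl (0 : 'M[B]_(p, q)) = 0.
Proof. by apply: amplP => i a j b; rewrite amplE !mxE linear0 mxE. Qed.

Lemma amplM p q r (x : 'M[B]_(p, q)) (y : 'M[B]_(q, r)) :
  ampl (x *m y) = ampl x *m ampl y.
Proof.
apply: amplP => i a j b; rewrite amplE !mxE linear_sum summxE sum_vec.
apply: eq_bigr => l _; rewrite (inclM iotaP) mxE; apply: eq_bigr => c _.
by rewrite !amplE.
Qed.

Lemma ampl_adj p q (x : 'M[B]_(p, q)) : ampl (adj x) = adj (ampl x).
Proof. by apply: amplP => i a j b; rewrite adjE !amplE adjE (incl_star iotaP) mxE. Qed.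

Lemma mxl1_ampl p q (x : 'M[B]_(p, q)) : mxl1 (ampl x) <= (K * K)%:R * mxl1 x.
Proof.
rewrite /mxl1 mulr_sumr sum_vec; apply: ler_sum => i _.
apply: (@le_trans _ _ (\sum_(a < K) \sum_(j < q) K%:R * cnorm (x i j))).
  apply: ler_sum => a _; rewrite sum_vec; apply: ler_sum => j _.
  apply: (@le_trans _ _ (\sum_(b < K) cnorm (x i j))).
    apply: ler_sum => b _; rewrite amplE -(incl_norm iotaP); exact: mat_norm_entry.
  by rewrite sumr_const card_ord mulr_natl.
by rewrite sumr_const card_ord -mulr_sumr -[X in X <= _]mulr_natl mulrA natrM.
Qed.

Lemma mx_cuntz_ampl p q (x : 'M[B]_p) (y : 'M[B]_q) : mx_cuntz x y -> mx_cuntz (ampl x) (ampl y).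
Proof.
move=> h e e0; have k0 : 0 < (K * K)%:R :> R by rewrite ltr0n.
have [r hr] := h _ (divr_gt0 e0 k0); exists (ampl r).
rewrite -ampl_adj -!amplM -amplB; apply: le_lt_trans (mxl1_ampl _) _.
by rewrite mulrC -ltr_pdivlMr.
Qed.

(** Selecting rows and columns by the same f is conjugation by a matrix of
    zeros and ones. *)
Lemma mx_cuntz_mxsub n m (f : 'I_n -> 'I_m) (b : 'M[A]_m) : mx_cuntz (mxsub f f b) b.
Proof.
have := mx_cuntz_conj (rowsub f 1%:M) b; congr mx_cuntz.
rewrite mul_rowsub_mx mul1mx -[X in X *m _]adjK -adjM mul_rowsub_mx mul1mx.
by apply/matrixP => i j; rewrite adjE mxE adjE starK !mxE.
Qed.

Lemma mx_cuntz_iota_entry p (x : 'M[B]_p) i : mx_cuntz (iota (x i i) : 'M[A]_K) (ampl x).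
Proof.
have := mx_cuntz_mxsub (fun a => mxvec_index i a) (ampl x); congr mx_cuntz.
by apply/matrixP => a b; rewrite mxE amplE.
Qed.

Lemma mx_cuntz_ampl_const (b : B) : mx_cuntz (ampl (const_mx b : 'M[B]_1)) (iota b : 'M[A]_K).
Proof.
have := mx_cuntz_mxsub (fun u : 'I_(1 * K) => (unvec u).2) (iota b : 'M[A]_K); congr mx_cuntz.
by apply/matrixP => u v; rewrite !mxE.
Qed.

Section DirectSum.
Variables (p q : nat).
Let E1 : 'M[B]_(p + q, p) := col_mx 1%:M 0.
Let E2 : 'M[B]_(p + q, q) := col_mx 0 1%:M.

(** The index pairs of the two sides differ by a permutation; it need not be
    written down, since the direct sum is E1 x E1* + E2 y E2* for the two
    coordinate inclusions, and [ampl] is multiplicative. *)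
Lemma mx_cuntz_ampl_dsum (x : 'M[B]_p) (y : 'M[B]_q) :
  mx_cuntz (ampl (dsum x y)) (dsum (ampl x) (ampl y)).
Proof.
have := mx_cuntz_conj (row_mx (ampl E1) (ampl E2)) (dsum (ampl x) (ampl y)); congr mx_cuntz.
rewrite adj_row /dsum mul_row_block !mulmx0 addr0 add0r mul_row_col.
rewrite -!ampl_adj -!amplM -amplD; congr ampl.
rewrite /E1 /E2 !adj_col !adj0 !adj1 !mul_col_mx !mul_mx_row.
by rewrite !(mul0mx, mulmx0, mul1mx, mulmx1) add_col_mx !add_row_mx !(addr0, add0r).
Qed.

Lemma mx_cuntz_dsum_ampl (x : 'M[B]_p) (y : 'M[B]_q) :
  mx_cuntz (dsum (ampl x) (ampl y)) (ampl (dsum x y)).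
Proof.
have := mx_cuntz_conj (col_mx (ampl (adj E1)) (ampl (adj E2))) (ampl (dsum x y)); congr mx_cuntz.
rewrite adj_col mul_col_mx mul_col_row -!ampl_adj !adjK -!amplM.
rewrite [in RHS]/dsum -(ampl0 p q) -(ampl0 q p).
rewrite /E1 /E2 !adj_col !adj0 !adj1 /dsum !mul_row_block !mul_row_col.
by rewrite !(mul0mx, mulmx0, mul1mx, mulmx1, addr0, add0r).
Qed.
End DirectSum.

Definition minf_ampl (x : minf B) : minf A :=
  @minf_mk _ _ (k + projT1 x * K) (ampl (minf_mx x)).

Lemma minf_cuntz_ampl x y : minf_cuntz x y -> minf_cuntz (minf_ampl x) (minf_ampl y).
Proof. exact: mx_cuntz_ampl. Qed.

Lemma minf_cuntz_ampl_dsum x y :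
  minf_cuntz (minf_ampl (minf_dsum x y)) (minf_dsum (minf_ampl x) (minf_ampl y)).
Proof. exact: (mx_cuntz_ampl_dsum (minf_mx x) (minf_mx y)). Qed.

Lemma minf_cuntz_dsum_ampl x y :
  minf_cuntz (minf_dsum (minf_ampl x) (minf_ampl y)) (minf_ampl (minf_dsum x y)).
Proof. exact: (mx_cuntz_dsum_ampl (minf_mx x) (minf_mx y)). Qed.

Lemma minf_cuntz_ampl_sum n (x : 'I_n -> minf B) :
  minf_cuntz (minf_ampl (minf_sum x)) (minf_sum (fun j => minf_ampl (x j))).
Proof.
elim: n x => [|n IH] x.
  rewrite /minf_sum !big_ord0 /minf_cuntz.
  have -> : minf_mx (minf_ampl (minf0 B)) = 0 by exact: (ampl0 1 1).
  exact: mx_cuntz0.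
rewrite !minf_sumS; apply: minf_cuntz_trans (minf_cuntz_ampl_dsum _ _) _.
by apply: minf_cuntz_dsum => //; apply: mx_cuntz_refl.
Qed.

Lemma minf_cuntz_sum_ampl n (x : 'I_n -> minf B) :
  minf_cuntz (minf_sum (fun j => minf_ampl (x j))) (minf_ampl (minf_sum x)).
Proof.
elim: n x => [|n IH] x; first by rewrite /minf_sum !big_ord0 /minf_cuntz; apply: mx_cuntz0.
rewrite !minf_sumS; apply: minf_cuntz_trans (minf_cuntz_dsum_ampl _ _).
by apply: minf_cuntz_dsum => //; apply: mx_cuntz_refl.
Qed.

Lemma minf_ampl_positive x : minf_positive x -> minf_positive (minf_ampl x).
Proof.
case: x => l a [/= y ->]; exists (ampl (y : 'M[B]_l.+1)).
rewrite /= !mat_starE -[RHS]/(adj (ampl y) *m ampl y) -ampl_adj -amplM.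
by [].
Qed.

End Amplification.

(** * Tracial approximation *)

Section Bounds.
Variables (R : realType) (D : cstarType R).
Implicit Types (a b c h p g z w : D) (r : R).
Local Notation sc := (@sc R D).

(** p - g = p (1 - g) p* and 1 - (p - g) = (1 - p) (1 - p)* + g. *)
Lemma proj_sub_nonneg p g : p * p = p -> star p = p -> p * g = g ->
  nonneg g -> nonneg (1 - g) -> nonneg (p - g) /\ nonneg (1 - (p - g)).
Proof.
move=> pp sp pg ng n1g; have sg := nonneg_star ng.
have gp : g * p = g by rewrite -{1}sg -{1}sp -starM pg.
split.
  have := nonneg_conj p n1g; congr nonneg.
  have -> : p * (1 - g) * star p = p * star p - p * g * star p by nc D.
  by rewrite sp pp pg gp.
have -> : 1 - (p - g) = (1 - p) * star (1 - p) + g.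
  rewrite starB star1 sp; have -> : (1 - p) * (1 - p) = 1 - p - (p - p * p) by nc D.
  by rewrite pp; nc D.
by apply: nonnegD => //; apply: nonneg_mul_star.
Qed.

Lemma cnorm_sym z w r : star z = z -> cnorm (z - w) <= r ->
  cnorm (z - sc 2^-1 * (w + star w)) <= r.
Proof.
move=> sz h; have -> : z - sc 2^-1 * (w + star w) = sc 2^-1 * ((z - w) + star (z - w)).
  by rewrite starB sz -[X in X - _](sc_half_double z); nc D.
rewrite cnorm_scM ger0_norm ?invr_ge0 //.
by have := cnormD (z - w) (star (z - w)); rewrite cnorm_starE; lra.
Qed.

(** The difference of the two sides is (2h - 1) a (2h - 1). *)
Lemma cle_corners a h : nonneg a -> star h = h ->
  cle a (sc 2 * (h * a * h + (1 - h) * a * (1 - h))).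
Proof.
move=> na sh; rewrite /cle; have := nonneg_conj (h - (1 - h)) na; congr nonneg.
rewrite !starB star1 sh (_ : 2 = 1 + 1) // scD sc1; nc D.
Qed.

(** Replace h a h by c + r and the corner at 1 - h by a multiple of
    (1 - h)^2 in [cle_corners]. *)
Lemma cle_corner_sum a h c r : nonneg a -> nonneg h ->
  cle (h * a * h) (c + sc r) ->
  cle (a - sc (2 * r)) (sc 2 * (c + sc (cnorm a) * ((1 - h) * (1 - h)))).
Proof.
move=> na nh hc; have sh := nonneg_star nh.
have h1 : cle ((1 - h) * a * (1 - h)) (sc (cnorm a) * ((1 - h) * (1 - h))).
  have := cle_conj (1 - h) (nonneg_gap (nonneg_star na) (lexx _) : cle a _).
  by rewrite starB star1 sh; congr cle; nc D.
have two0 : (0 : R) <= 2 by rewrite ler0n.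
have h2 : cle a (sc 2 * (c + sc r + sc (cnorm a) * ((1 - h) * (1 - h)))) :=
  cle_trans (cle_corners na sh) (cle_scM two0 (cleD hc h1)).
by move: h2; rewrite /cle; congr nonneg; rewrite scM; nc D.
Qed.

Lemma cuntz_le_sc r b : 0 <= r -> cuntz_le (sc r * b) b.
Proof.
move=> r0; have := cuntz_le_conj (sc (Num.sqrt r)) b; congr cuntz_le.
have -> : sc (Num.sqrt r) * b * star (sc (Num.sqrt r)) =
  sc (Num.sqrt r) * sc (Num.sqrt r) * b by rewrite star_sc; nc D.
by rewrite -scM -expr2 sqr_sqrtr.
Qed.

End Bounds.

Section MatrixEntries.
Variables (R : realType) (A : cstarType R) (k : nat).

Lemma nonneg_diag (x : matalg A k) i : nonneg x -> nonneg (x i i).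
Proof.
move=> /positiveP[y ->]; rewrite mxE; apply: nonneg_sum => j _.
by rewrite mxE; apply: nonneg_star_mul.
Qed.

Lemma nonneg_diag_eq0 (x : matalg A k) : nonneg x -> (forall i, x i i = 0) -> x = 0.
Proof.
move=> /positiveP[y ->] h; suff -> : y = 0 by rewrite mulr0.
apply/matrixP => j i; rewrite [RHS]mxE; have := h i.
rewrite mxE (bigD1 j) //= mxE => h0.
suff h1 : cnorm (y j i) ^+ 2 <= 0.
  by apply: cnorm_eq0; apply/eqP; rewrite -sqrf_eq0 eq_le h1 sqr_ge0.
rewrite -cnorm_star -(@cnorm0 _ A) -h0.
apply: cle_norm; first exact: nonneg_star_mul.
rewrite /cle addrAC subrr add0r; apply: nonneg_sum => l _.
by rewrite mxE; apply: nonneg_star_mul.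
Qed.

Lemma mat_sc_diag r i : (sc (matalg A k) r) i i = sc A r.
Proof. by rewrite !mxE eqxx. Qed.

(** Conjugate the direct sum by the row (1, sqrt r sqrt c). *)
Lemma mx_cuntz_row_dsum (c0 c : matalg A k) r : 0 <= r -> nonneg c ->
  mx_cuntz (c0 + sc (matalg A k) r * (c * c)) (dsum (c0 : 'M[A]_k.+1) (c : 'M[A]_k.+1)).
Proof.
move=> r0 /sqrtP[q [sq _ qq _]].
set s := sc (matalg A k) (Num.sqrt r).
have ss : star s = s by apply: star_sc.
have := mx_cuntz_conj (row_mx 1%:M (s * q : matalg A k))
  (dsum (c0 : 'M[A]_k.+1) (c : 'M[A]_k.+1)); congr mx_cuntz.
rewrite adj_row adj1 /dsum mul_row_block !mulmx0 addr0 add0r mul_row_col.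
rewrite mul1mx mulmx1 -mat_starE; congr (_ + _).
rewrite -[LHS]/((s * q) * c * star (s * q)) starM ss sq.
have -> : s * q * c * (q * s) = s * s * (c * c).
  by rewrite mulrA /s scC -qq !mulrA.
by rewrite /s -scM -expr2 sqr_sqrtr.
Qed.

End MatrixEntries.

Section DivisibleElement.
Variables (R : realType) (m n : nat) (Omega : cstarType R -> Prop) (A : cstarType R).
Hypothesis divisible : forall B : cstarType R, Omega B -> weakly_divisible B m n.

Lemma const_mx_positive (B : cstarType R) (b : B) : nonneg b ->
  minf_positive (@minf_mk _ B 0 (const_mx b : 'M[B]_1)).
Proof.
move=> /positiveP[y ->]; exists (const_mx y : 'M[B]_1).
by apply/matrixP => i j; rewrite /= !mxE big_ord1 !mxE.
Qed.

(** Weak divisibility of B at a 1 x 1 matrix, read back in B through the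
    diagonal entry of the cut-down. *)
Lemma divisible_element (B : cstarType R) (b : B) (e : R) : Omega B -> nonneg b -> 0 < e ->
  exists (x : 'I_n -> minf B) (c : matalg B 0),
    [/\ forall j, minf_positive (x j),
        forall j, minf_cuntz (minf_mul m (x j)) (@minf_mk _ B 0 (const_mx b : 'M[B]_1)),
        mx_cuntz (c : 'M[B]_1) (minf_mx (minf_sum x)),
        nonneg (c ord0 ord0) & cle b (c ord0 ord0 + sc B e)].
Proof.
move=> OB nb e0; set bm : matalg B 0 := const_mx b : 'M[B]_1.
have pb : minf_positive (minf_mk bm) by apply: const_mx_positive.
have [x [px hx hs]] := divisible OB pb e0.
have nbm : nonneg bm by apply/positiveP.
have [] := @cut_downP _ (matalg B 0) bm e (nonneg_star nbm).
set c := cut_down _ _ _ => nc nd _.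
exists x, c; split=> //.
- by move=> j; apply/minf_cuntzP/hx.
- by move/minf_cuntzP: hs.
- exact: (nonneg_diag ord0 nc).
have := nonneg_diag ord0 nd; congr nonneg.
have -> : (c - (bm - sc (matalg B 0) e)) ord0 ord0 =
  c ord0 ord0 - (b - (sc (matalg B 0) e) ord0 ord0).
  by rewrite !mxE.
by rewrite mat_sc_diag; nc B.
Qed.

End DivisibleElement.

(** Let y in B approximate a h.  The element w = (1 - g') y of B is close to
    h a h, and b is the cut-down by d of its real part b0.  Then b0 - d <= h a h
    makes b Cuntz below h a h, while h a h <= b0 + d and b0 <= b + d give the
    first inequality. *)
Lemma WTA_core (R : realType) (Omega : cstarType R -> Prop) (D : cstarType R) (a a0 : D) (d : R) :
  WTA (@cnorm R D) Omega -> nonneg a -> nonneg a0 -> a0 <> 0 -> 0 < d ->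
  exists (h : D) (B : cstarType R) (iota : {linear B -> D}) (b : B),
    [/\ Omega B, cstar_inclusion (@cnorm R D) iota, nonneg h, nonneg (1 - h) & nonneg b] /\
    [/\ cle (h * a * h) (iota b + (sc D d + sc D d)),
        forall r, 0 <= r -> cle (iota (sc B r)) (sc D r),
        cuntz_le (iota b) a, cuntz_le (1 - h) a0 & cnorm a0 - d <= cnorm (h * a0 * h)].
Proof.
move=> [_ wta] na na0 a00 d0.
have pa0 : positive a0 by apply/positiveP.
have [p [g [B [iota [[[pp sp] [pg pg1] [iP OB] [g' _ gE] p1] [F1 _ F3 F4]]]]]] :=
  wta d [:: a] a0 d0 pa0 a00.
have ng : nonneg g by apply/positiveP.
have ng1 : nonneg (1 - g) by apply/positiveP.
have pgE : p * g = g by rewrite -p1 -gE -(inclM iP) mul1r.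
have [nh nh1] := proj_sub_nonneg pp sp pgE ng ng1.
set h := p - g in nh nh1 F1 F3 F4.
have hE : iota (1 - g') = h by rewrite linearB /= p1 gE.
have sh := nonneg_star nh.
have h1 : cnorm h <= 1 by apply: nonneg_norm_le => //; rewrite sc1.
have [_ [_ [y _ <-] hy]] := F1 a (mem_head _ _).
pose z := h * a * h; pose w := (1 - g') * y.
have sz : star z = z by rewrite /z !starM sh (nonneg_star na) mulrA.
have zw : cnorm (z - iota w) <= d.
  have -> : z - iota w = h * (a * h - iota y) by rewrite /w (inclM iP) hE mulrBr mulrA.
  apply: le_trans (cnormM _ _) _; apply: le_trans (ltW hy).
  by rewrite ler_piMl.
pose b0 : B := sc B 2^-1 * (w + star w).
have sb0 : star b0 = b0 by rewrite starM star_sc scC starD starK (addrC (star w)).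
have zb0 : cnorm (z - iota b0) <= d.
  have -> : iota b0 = sc D 2^-1 * (iota w + star (iota w)).
    by rewrite /b0 incl_sc linearD /= (incl_star iP).
  exact: cnorm_sym.
have sib0 : star (iota b0) = iota b0 by rewrite -(incl_star iP) sb0.
have [] := cut_downP d sb0; set b := cut_down _ _ _ => nb nbd bbd.
(* iota need not be unital: it maps sc r to r p, and p <= 1 *)
have p_le (r : R) : 0 <= r -> cle (iota (sc B r)) (sc D r).
  move=> r0; rewrite -[sc B r]mulr1 incl_sc p1 -[X in cle _ X]mulr1.
  apply: cle_scM => //; rewrite /cle.
  have -> : 1 - p = (1 - p) * star (1 - p).
    by rewrite starB star1 sp mulrBr mulr1 mulrBl mul1r pp subrr subr0.
  exact: nonneg_mul_star.
have ib0 : cle (iota b0) (iota b + sc D d).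
  apply: (@cle_trans _ _ (iota b + iota (sc B d))); last first.
    by apply: cleD; [exact: cle_refl|apply/p_le/ltW].
  rewrite -linearD; apply: (incl_cle iP).
  by rewrite /cle; have -> : b + sc B d - b0 = b - (b0 - sc B d) by nc B.
exists h, B, iota, b; split; split => //.
- apply: cle_trans (cle_close sz sib0 zb0) _; rewrite addrA.
  by apply: cleD => //; apply: cle_refl.
- apply: (@cuntz_le_trans _ _ z); last by have := cuntz_le_conj h a; rewrite sh.
  apply: (@cuntz_le_pos_part _ _ (iota b) (iota b0 - sc D d)).
  + exact: (incl_nonneg iP).
  + have -> : iota b * (iota b - (iota b0 - sc D d)) = iota (b * (b - (b0 - sc B d))).
      have -> : b * (b - (b0 - sc B d)) = b * (b - b0) + sc B d * b by nc B.
      rewrite (linearD iota) (inclM iP b) (linearB iota) (incl_sc iota d) /=.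
      by move: (iota b) (iota b0) => u v; nc D.
    by rewrite bbd linear0.
  + have zb0' : cnorm (iota b0 - z) <= d by rewrite cnormC.
    have := cle_close sib0 sz zb0'; rewrite /cle; congr nonneg; nc D.
- exact/cuntz_leP.
Qed.

Section MatrixStage.
Variables (R : realType) (m n : nat) (Omega : cstarType R -> Prop) (A : cstarType R).
Hypothesis divisible : forall B : cstarType R, Omega B -> weakly_divisible B m n.

(** The approximation step: [WTA_core] followed by weak divisibility of B,
    transported to matrices over A. *)
Lemma WTA_divisible k (a a0 : matalg A k) (e : R) :
  WTA (@mat_norm R A k) Omega -> nonneg a -> nonneg a0 -> a0 <> 0 -> 0 < e ->
  exists (h c : matalg A k) (y : 'I_n -> minf A),
    [/\ nonneg h, nonneg (1 - h), nonneg c & cle (h * a * h) (c + sc (matalg A k) e)] /\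
    [/\ forall j, minf_positive (y j),
        forall j, minf_cuntz (minf_mul m (y j)) (minf_mk a),
        mx_cuntz (c : 'M[A]_k.+1) (minf_mx (minf_sum y)),
        cuntz_le (1 - h) a0 &
        cnorm a0 - e <= cnorm (h * a0 * h)].
Proof.
move=> wta na na0 a00 e0.
(* the error is 2d from the core step and d from the cut-down of b *)
have d0 : 0 < e / 3 by lra.
have [h [B [iota [b [[OB iP nh nh1 nb] [hb p_le ba ha0 hn]]]]]] :=
  @WTA_core R Omega (matalg A k) a a0 (e / 3) wta na na0 a00 d0.
set d := e / 3 in d0 hb hn.
have [x [c [px hx hc nc bc]]] := divisible_element divisible OB nb d0.
have ibc : cle (iota b) (iota (c ord0 ord0) + sc (matalg A k) d).
  apply: (@cle_trans _ _ (iota (c ord0 ord0) + iota (sc B d))); last first.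
    by apply: cleD; [exact: cle_refl|apply/p_le/ltW].
  by rewrite -linearD; apply: (incl_cle iP).
exists h, (iota (c ord0 ord0)), (fun j => minf_ampl iota (x j)); split; split.
- exact: nh.
- exact: nh1.
- exact: (incl_nonneg iP).
- apply: (cle_trans hb).
  have -> : sc (matalg A k) e = sc _ d + (sc _ d + sc _ d).
    by rewrite -!scD; congr sc; rewrite /d; field.
  by rewrite [X in cle _ X]addrA; apply: cleD ibc (cle_refl _).
- by move=> j; apply: minf_ampl_positive.
- move=> j; apply: minf_cuntz_trans (minf_cuntz_sum_ampl iP _) _.
  apply: minf_cuntz_trans (minf_cuntz_ampl iP (hx j)) _.
  exact: (mx_cuntz_trans (mx_cuntz_ampl_const iota b) (proj1 (mx_cuntz_le _ _) ba)).
- apply: mx_cuntz_trans (mx_cuntz_iota_entry iota c ord0) _.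
  by apply: mx_cuntz_trans (mx_cuntz_ampl iP hc) _; apply: (minf_cuntz_ampl_sum iP).
- exact: ha0.
- by apply: le_trans hn; rewrite lerD2l lerN2 /d; lra.
Qed.

End MatrixStage.

(** Some diagonal entry of s is nonzero; put it in the corner of M_k(A). *)
Lemma small_element (R : realType) (A : cstarType R) (k : nat) (s : minf A) :
  minf_positive s -> minf_mx s <> 0 ->
  exists a0 : matalg A k, [/\ nonneg a0, a0 <> 0 & mx_cuntz (a0 : 'M[A]_k.+1) (minf_mx s)].
Proof.
case: s => l s /positiveP ns s0; change (nonneg (s : matalg A l)) in ns.
change ((s : 'M[A]_l.+1) <> 0) in s0; change (minf_mx (existT _ l s)) with (s : 'M[A]_l.+1).
have [i si0] : exists i, (s : 'M[A]_l.+1) i i <> 0.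
  apply: contrapT => h; apply: s0; apply: nonneg_diag_eq0 => // i.
  by apply: contrapT => hi; apply: h; exists i.
have nsi : nonneg ((s : 'M[A]_l.+1) i i) := nonneg_diag i ns.
set t : A := (s : 'M[A]_l.+1) i i in si0 nsi.
pose E : 'M[A]_(k.+1, 1) := delta_mx ord0 ord0.
have EE : adj E *m E = 1%:M.
  apply/matrixP => u v; rewrite !ord1 mxE (bigD1 ord0) //= big1 ?addr0 => [|j j0].
    by rewrite adjE !mxE !eqxx star1 mulr1.
  by rewrite [X in _ * X]mxE (negPf j0) mulr0.
pose a0 : 'M[A]_k.+1 := E *m const_mx t *m adj E.
have tE : adj E *m a0 *m E = const_mx t.
  by rewrite /a0 !mulmxA EE mul1mx -mulmxA EE mulmx1.
exists a0; split.
- have [y ty] := (positiveP t).2 nsi.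
  apply/positiveP; exists (E *m const_mx y *m adj E); rewrite mat_starE.
  rewrite -[RHS]/(adj (E *m const_mx y *m adj E) *m (E *m const_mx y *m adj E)).
  rewrite !adjM adjK /a0.
  have -> : (const_mx t : 'M[A]_1) = adj (const_mx y : 'M[A]_1) *m const_mx y.
    by apply/matrixP => u v; rewrite mxE mxE big_ord1 adjE !mxE.
  have -> : E *m (adj (const_mx y) *m adj E) *m (E *m const_mx y *m adj E) =
    E *m adj (const_mx y) *m (adj E *m E) *m const_mx y *m adj E by rewrite !mulmxA.
  by rewrite EE mulmx1 !mulmxA.
- move=> a00; apply: si0; have := congr1 (fun M : 'M[A]_1 => M ord0 ord0) tE.
  by rewrite (a00 : a0 = 0) mulmx0 mul0mx !mxE => ->.
- apply: mx_cuntz_trans (mx_cuntz_conj E (const_mx t)) _.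
  have := mx_cuntz_mxsub (fun _ : 'I_1 => i) (s : 'M[A]_l.+1); congr mx_cuntz.
  by apply/matrixP => u v; rewrite !mxE.
Qed.

(** Rordam's lemma for the cut-down computed by functional calculus in
    M_k(A). *)
Lemma mx_cuntz_cut_down (R : realType) (A : cstarType R) (k : nat) (a z : matalg A k) (e : R) :
  nonneg a -> cle (a - sc (matalg A k) e) z ->
  mx_cuntz (cut_down (@mat_norm R A k) a e : 'M[A]_k.+1) (z : 'M[A]_k.+1).
Proof.
move=> na az; apply/(mx_cuntz_le (cut_down (@mat_norm R A k) a e : matalg A k) z).
have [nc _ hc] := @cut_downP R (matalg A k) a e (nonneg_star na).
exact: (cuntz_le_pos_part nc hc az).
Qed.

Lemma minf_cuntz_absorb (R : realType) (A : cstarType R) n (y : 'I_n.+1 -> minf A) (s : minf A) :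
  minf_cuntz (minf_dsum (minf_sum y) s)
      (minf_sum (fun j => if j == ord0 then minf_dsum (y ord0) s else y j)).
Proof.
rewrite !minf_sumS /=.
set rest := minf_sum (fun j => y (lift ord0 j)).
apply: (@minf_cuntz_trans _ _ (minf_dsum (minf_dsum (y ord0) rest) (minf_dsum s (minf0 A)))).
  by apply: minf_cuntz_dsum; [exact: mx_cuntz_refl|exact: (mx_cuntz_inl (minf_mx s) (minf_mx (minf0 A)))].
apply: minf_cuntz_trans (minf_cuntz_dsumACA _ _ _ _) _.
apply: minf_cuntz_dsum; first exact: mx_cuntz_refl.
exact: (mx_cuntz_dsum0 1 (minf_mx rest)).
Qed.

Theorem theorem3p7 (R : realType) (m n : nat)
    (Omega : cstarType R -> Prop) (A : cstarType R) :
  (1 <= m)%N -> (1 <= n)%N -> n <> m ->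
  (forall B : cstarType R, Omega B -> weakly_divisible B m n) ->
  WTA (@cnorm R A) Omega ->
  simple_algebra (@cnorm R A) ->
  stably_finite A ->
  (forall k : nat, WTA (@mat_norm R A k) Omega) ->
  secondly_weakly_divisible A m n.
Proof.
move=> _ n1 _ hdiv _ _ _ hwta [k a] e /positiveP na e0.
case: n n1 hdiv => // n _ hdiv.
change (nonneg (a : matalg A k)) in na.
have [a_0|a_0] := pselect (a = 0).
  exists (fun=> minf0 A); split.
  - by move=> j; exists 0; rewrite mulr0.
  - move=> j; apply/minf_cuntzP; rewrite /minf_cuntz.
    have -> : minf_mx (minf_mul m (minf0 A)) = 0 by apply: minf_sum_eq0.
    exact: mx_cuntz0.
  - apply/minf_cuntzP; have h : mx_cuntz (cut_down (@mat_norm R A k) a e : 'M[A]_k.+1) (0 : 'M[A]_k.+1).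
      apply: (mx_cuntz_cut_down (z := 0) na); rewrite a_0 /cle sub0r sub0r opprK.
      by apply: nonneg_sc; apply: ltW.
    exact: (mx_cuntz_trans h (mx_cuntz0 _ _)).
have an0 : 0 < cnorm (a : matalg A k).
  by rewrite lt_def cnorm_ge0 andbT; apply/eqP => /cnorm_eq0.
set r := cnorm (a : matalg A k) in an0.
(* with error r / 3, the case c = 0 would give r - r / 3 <= r / 3 *)
have r3 : 0 < r / 3 by lra.
have [h [c [y [[nh nh1 nc hc] [py my cy _ hn]]]]] :=
  WTA_divisible hdiv (hwta k) na na a_0 r3.
have [j yj] : exists j, minf_mx (y j) <> 0.
  apply: contrapT => hj; have y0 : minf_mx (minf_sum y) = 0.
    by apply: minf_sum_eq0 => j; apply: contrapT => yj; apply: hj; exists j.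
  have c0 : c = 0 by move: cy; rewrite y0; apply: mx_cuntz0_eq0.
  have nhah : nonneg (h * a * h).
    by have := nonneg_conj h na; rewrite (nonneg_star nh).
  have := nonneg_norm_le (ltW r3) nhah; rewrite c0 add0r in hc; move=> /(_ hc).
  by move: hn; rewrite -/r; lra.
have [a0 [na0 a00 a0s]] := small_element k (py j) yj.
(* the factor 2 in [cle_corners] doubles the error *)
have e2 : 0 < e / 2 by lra.
have [h' [c' [y' [[nh' nh1' nc' hc'] [py' my' cy' ha0 _]]]]] :=
  WTA_divisible hdiv (hwta k) na na0 a00 e2.
exists (fun i => if i == ord0 then minf_dsum (y' ord0) (y j) else y' i); split.
- move=> i; case: ifP => _ //; exact: minf_positive_dsum.
- move=> i; apply/minf_cuntzP; case: ifP => _.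
    by apply: minf_cuntz_trans (minf_cuntz_mul_dsum _ _ _) _; apply: minf_cuntz_dsum.
  by apply: minf_cuntz_trans (my' i) _; apply: mx_cuntz_inl.
apply/minf_cuntzP; apply: minf_cuntz_trans (minf_cuntz_absorb _ _).
have hz := cle_corner_sum na nh' hc'.
have e22 : 2 * (e / 2) = e by rewrite mulrC divfK ?pnatr_eq0.
rewrite e22 in hz.
apply: mx_cuntz_trans (mx_cuntz_cut_down na hz) _.
apply: mx_cuntz_trans (proj1 (mx_cuntz_le _ _) (cuntz_le_sc _ (ler0n R 2))) _.
apply: mx_cuntz_trans (mx_cuntz_row_dsum c' (cnorm_ge0 _) nh1') _.
apply: (@mx_cuntz_dsum _ _ _ _ _ _ (c' : 'M[A]_k.+1) (1 - h' : matalg A k)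
  (minf_mx (minf_sum y')) (minf_mx (y j)) cy').
exact: (mx_cuntz_trans (proj1 (mx_cuntz_le _ _) ha0) a0s).
Qed.
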